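(* Let $\mathcal{C}_{mcd}$ denote the family of all mutually completely dependent bivariate copulas. The mapping $\ell:\mathcal{C}_{mcd}\to[\frac{1}{\sqrt2},1]$, assigning to each $A_h\in\mathcal{C}_{mcd}$ its length measure $\ell(A_h)$, is continuous with respect to the uniform metric $d_\infty$.
   Context: $\lambda$ denotes Lebesgue measure on the Borel sets of $[0,1]$. The uniform metric on bivariate copulas is $d_\infty(A,B)=\sup_{(x,y)\in[0,1]^2}|A(x,y)-B(x,y)|$. Mutually completely dependent copulas: for a (Borel measurable) transformation $h:[0,1]\to[0,1]$ that is $\lambda$-preserving (i.e. $\lambda(h^{-1}(E))=\lambda(E)$ for every Borel set $E\subseteq[0,1]$), the completely dependent copula $A_h$ is the copula for which $K(x,E)=\mathbf 1_E(h(x))$ is a version of the regular conditional distribution of $Y$ given $X=x$ when $(X,Y)\sim A_h$; equivalently $A_h(x,y)=\lambda\{t\in[0,x]: h(t)\le y\}$. $A_h$ is called mutually completely dependent if $h$ is moreover bijective. Length measure: for a copula $A$ and $t\in[0,1]$ let $[A]_t=\{(x,y)\in[0,1]^2: A(x,y)\ge t\}$, let $\Gamma_{A,t}$ be the boundary of $[A]_t$ in $(0,1)^2$, and let $L_A(t)=H_1(\Gamma_{A,t})$ be its arc-length ($H_1$ is one-dimensional Hausdorff measure). The length measure of $A$ is $\ell(A)=\int_{(0,1)}L_A(t)\,d\lambda(t)$; one has $\ell(A)\in[\frac1{\sqrt2},1]$ for every copula $A$. *)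

(* Defs.v *)
From HB Require Import structures.
From mathcomp Require Import all_boot all_order all_algebra.
From mathcomp Require Import all_classical all_reals all_analysis.

Set Implicit Arguments.
Unset Strict Implicit.
Unset Printing Implicit Defensive.

Import Order.TTheory GRing.Theory Num.Theory.
Import numFieldNormedType.Exports.

Local Open Scope classical_set_scope.
Local Open Scope ring_scope.

Definition unit_itv (R : realType) : set R := `[0, 1]%classic.

Definition unit_square (R : realType) : set (R * R) :=
  @unit_itv R `*` @unit_itv R.

Definition open_unit_square (R : realType) : set (R * R) :=
  `]0, 1[%classic `*` `]0, 1[%classic.

(* A copula is represented by any function on the plane whose restriction to
   the unit square is one; no notion below depends on the values elsewhere. *)
Definition copula (R : realType) (A : R * R -> R) : Prop :=
  [/\ forall x : R, x \in `[0, 1] -> A (x, 0) = 0 /\ A (0, x) = 0,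
      forall x : R, x \in `[0, 1] -> A (x, 1) = x /\ A (1, x) = x
    & forall x1 x2 y1 y2 : R, 0 <= x1 -> x1 <= x2 -> x2 <= 1 ->
        0 <= y1 -> y1 <= y2 -> y2 <= 1 ->
        0 <= A (x2, y2) - A (x2, y1) - A (x1, y2) + A (x1, y1)].

Definition lebesgue_preserving (R : realType) (h : R -> R) : Prop :=
  [/\ set_fun (@unit_itv R) (@unit_itv R) h,
      measurable_fun (@unit_itv R) h
    & forall E : set R, measurable E -> E `<=` @unit_itv R ->
        lebesgue_measure ((@unit_itv R) `&` h @^-1` E) = lebesgue_measure E].

Definition cd_copula (R : realType) (h : R -> R) (p : R * R) : R :=
  fine (lebesgue_measure [set t : R | t \in `[0, p.1] /\ h t <= p.2]).

Definition mcd_copula (R : realType) (A : R * R -> R) : Prop :=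
  copula A /\
  exists h : R -> R,
    [/\ lebesgue_preserving h,
        set_bij (@unit_itv R) (@unit_itv R) h
      & forall p, unit_square p -> A p = cd_copula h p].

Definition d_infty (R : realType) (A B : R * R -> R) : R :=
  sup [set `|A p - B p| | p in @unit_square R].

(* The canonical norm on R * R is the max norm, whereas arc-length requires
   the Euclidean distance. *)
Definition edist (R : realType) (p q : R * R) : R :=
  Num.sqrt ((p.1 - q.1) ^+ 2 + (p.2 - q.2) ^+ 2).

(* The value 0 is added so that the empty set has diameter 0, not -oo. *)
Definition ediam (R : realType) (S : set (R * R)) : \bar R :=
  ereal_sup (0%E |` [set (edist p.1 p.2)%:E | p in S `*` S]).

Definition hausdorff1_pre (R : realType) (delta : R) (S : set (R * R))
    : \bar R :=
  ereal_inf [set (\sum_(0 <= i <oo) ediam (U i))%E | U in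
    [set U : nat -> set (R * R) |
      S `<=` \bigcup_i U i /\ forall i, (ediam (U i) <= delta%:E)%E]].

(* With diameters unscaled, the one-dimensional Hausdorff measure of a segment
   is its length. *)
Definition hausdorff1 (R : realType) (S : set (R * R)) : \bar R :=
  ereal_sup [set hausdorff1_pre delta S | delta in [set delta : R | 0 < delta]].

Definition upper_level (R : realType) (A : R * R -> R) (t : R)
    : set (R * R) :=
  [set p | p \in @unit_square R /\ t <= A p].

(* As the open square is open in the plane, the boundary relative to it is the
   trace of the boundary in the plane. *)
Definition level_boundary (R : realType) (A : R * R -> R) (t : R)
    : set (R * R) :=
  (closure (upper_level A t) `\` interior (upper_level A t))
    `&` @open_unit_square R.

Definition level_length (R : realType) (A : R * R -> R) (t : R) : \bar R :=
  hausdorff1 (level_boundary A t).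

Definition length_measure (R : realType) (A : R * R -> R) : \bar R :=
  (\int[lebesgue_measure]_(t in `]0%R, 1%R[) level_length A t)%E.

(* Main.v *)
(** For an arbitrary copula A write u = x - y and cut the unit square into an
    n x n grid.  A level curve G_t is a decreasing chain, so its part in a cell
    has length at most the sum X + Y of the measures of its two projections, and
    by Fubini the integral of X + Y over t is governed by the values of A at the
    corners of the cell.  Two refinements are used.

    From above: if A is close to (x, y) |-> x + y + c on a cell (small "defect"
    at the corners), then along G_t the increments of x and y differ at most by
    the increments of two monotone functions of total variation the defect,
    hence the length is at most (X + Y + defect) / sqrt 2, at every scale.

    From below: the length dominates X, Y and (X + Y) / sqrt 2, separately in
    each cell once the cells are shrunk to be a positive distance apart.

    So for any set G of cells, the length measure differs from
    1 - (2 - sqrt 2) |G| / n^2 by O(1 / n) plus an error which depends only on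
    the values of A at the grid points, and is therefore continuous for the
    uniform metric.  If A is mutually completely dependent, Lusin's theorem
    gives a compact set K on which both h and its inverse are uniformly
    continuous, and taking for G the cells that lie above the graph of h over K
    makes the error small; this fixes n and G, and the same n and G then serve
    for all copulas close to A. *)
Require Import Defs.
From mathcomp Require Import all_boot all_order all_algebra.
From mathcomp Require Import all_classical all_reals all_analysis.
From mathcomp Require Import measurable_realfun ring lra.
Import Order.TTheory GRing.Theory Num.Theory.
Import numFieldNormedType.Exports.
Import Defs.
Local Open Scope classical_set_scope.
Local Open Scope ring_scope.
Set Implicit Arguments.
Unset Strict Implicit.
Unset Printing Implicit Defensive.

(** * Hausdorff measure: coverings *)

Lemma edist_le (R : realType) (p q : R * R) (c : R) : 0 <= c ->
  (p.1 - q.1) ^+ 2 + (p.2 - q.2) ^+ 2 <= c ^+ 2 -> edist p q <= c.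
Proof. by move=> c0 h; rewrite /edist -(ger0_norm c0) -sqrtr_sqr ler_wsqrtr. Qed.

Lemma le_edist (R : realType) (p q : R * R) (c : R) :
  c ^+ 2 <= (p.1 - q.1) ^+ 2 + (p.2 - q.2) ^+ 2 -> c <= edist p q.
Proof.
by move=> h; apply: le_trans (ler_norm c) _; rewrite -sqrtr_sqr ler_wsqrtr.
Qed.

Lemma edist_le_ediam (R : realType) (S : set (R * R)) (p q : R * R) :
  S p -> S q -> ((edist p q)%:E <= ediam S)%E.
Proof.
by move=> Sp Sq; apply: ereal_sup_ubound; right; exists (p, q).
Qed.

Lemma ediam_ge0 (R : realType) (S : set (R * R)) : (0 <= ediam S)%E.
Proof. by apply: ereal_sup_ubound; left. Qed.

Lemma ediam_le (R : realType) (S : set (R * R)) (c : R) : 0 <= c ->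
  (forall p q, S p -> S q -> edist p q <= c) -> (ediam S <= c%:E)%E.
Proof.
move=> c0 h; apply: ge_ereal_sup => _ [->|[[p q] [/= Sp Sq] <-]].
  by rewrite lee_fin.
by rewrite lee_fin; apply: h.
Qed.

Lemma ediam0 (R : realType) : ediam (set0 : set (R * R)) = 0%E.
Proof. by apply/eqP; rewrite eq_le ediam_ge0 andbT; exact: ediam_le. Qed.

(** The finite cover is padded with empty sets, whose diameter is 0 because [ediam] adjoins 0. *)
Lemma hausdorff1_pre_le_sum (R : realType) (I : finType) (U : I -> set (R * R))
    (delta : R) (S : set (R * R)) :
  0 <= delta -> S `<=` \bigcup_i U i ->
  (forall i, (ediam (U i) <= delta%:E)%E) ->
  (hausdorff1_pre delta S <= \sum_(i : I) ediam (U i))%E.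
Proof.
move=> d0 SU Ud.
pose s := [seq U i | i <- enum I].
pose V k := nth set0 s k.
have Vd k : (ediam (V k) <= delta%:E)%E.
  rewrite /V; case: (ltnP k (size s)) => ks.
    by have /mapP[i _ ->] := mem_nth set0 ks.
  by rewrite nth_default // ediam0 lee_fin.
have SV : S `<=` \bigcup_k V k.
  move=> p /SU[i _ Uip]; exists (index i (enum I)) => //.
  by rewrite /V (nth_map i) ?index_mem ?mem_enum // nth_index // mem_enum.
apply: (@le_trans _ _ (\sum_(0 <= k <oo) ediam (V k))%E).
  by apply: ereal_inf_lbound; exists V.
have s0 k : (0 <= ediam (V k))%E by exact: ediam_ge0.
rewrite (nneseries_split 0 (size s)) // add0n [X in (_ + X)%E]eseries0 ?adde0.
  by rewrite -(big_nth set0 xpredT (@ediam R)) big_map big_enum.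
by move=> k ks _; rewrite /V nth_default // ediam0.
Qed.

Lemma natSinv_lt (R : realType) (e : R) : 0 < e -> exists n, n.+1%:R^-1 < e.
Proof.
move=> e0; exists (Num.truncn e^-1).
rewrite invf_plt ?posrE ?ltr0n //; exact: truncnS_gt.
Qed.

Lemma archi_inv_le (R : realType) (b e : R) : 0 < e ->
  exists n : nat, b / n.+1%:R <= e.
Proof.
move=> e0; exists (Num.truncn (b / e)).
rewrite ler_pdivrMr ?ltr0n // -ler_pdivrMl // mulrC.
exact/ltW/truncnS_gt.
Qed.

(* A map expanding the Euclidean distance has a 1-Lipschitz inverse, so that
   the length of S is at most the length of an interval containing its image. *)
Lemma hausdorff1_le_sum (R : realType) (I : finType) (S : I -> set (R * R))
    (Psi : I -> R * R -> R) (b : I -> R) (T : set (R * R)) :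
  T `<=` \bigcup_i S i -> (forall i, 0 <= b i) ->
  (forall i p q, S i p -> S i q -> edist p q <= `|Psi i p - Psi i q|) ->
  (forall i p q, S i p -> S i q -> Psi i p - Psi i q <= b i) ->
  (hausdorff1 T <= (\sum_i b i)%:E)%E.
Proof.
move=> TS b0 hexp hosc; apply: ge_ereal_sup => _ [delta /= d0 <-].
(* One n serves every i, since each [b i] is at most the sum of all of them. *)
have [n hn] : exists n : nat, forall i, b i / n.+1%:R <= delta.
  have [n hn] := archi_inv_le (\sum_i b i) d0; exists n => i.
  apply: le_trans hn; rewrite ler_wpM2r ?invr_ge0 //.
  by rewrite (bigD1 i) //= lerDl sumr_ge0.
have n0 : (0 : R) < n.+1%:R by rewrite ltr0n.
pose w i := b i / n.+1%:R.
have w0 i : 0 <= w i by rewrite /w divr_ge0 // ltW.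
(* For an empty [S i] this is a default value, which is harmless: [a i] is only compared with values
   of [Psi i] on [S i]. *)
pose a i := inf [set Psi i p | p in S i].
have hinf i p : S i p -> a i <= Psi i p <= a i + b i.
  move=> Sp.
  have hlb : has_inf [set Psi i p | p in S i].
    split; first by exists (Psi i p), p.
    exists (Psi i p - b i) => _ [q Sq <-].
    by have := hosc i p q Sp Sq; lra.
  apply/andP; split.
    by apply: ge_inf; [case: hlb | exists p].
  rewrite -lerBlDr; apply: lb_le_inf; first by exists (Psi i p), p.
  by move=> _ [q Sq <-]; have := hosc i p q Sp Sq; lra.
(* [S i] is cut into n + 1 slices on which [Psi i] oscillates by at most [w i]; their diameters add
   up to at most [b i]. *)
pose U (ik : I * 'I_n.+1) : set (R * R) := [set p | S ik.1 p /\
  a ik.1 + ik.2%:R * w ik.1 <= Psi ik.1 p <= a ik.1 + ik.2.+1%:R * w ik.1].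
have Ud ik : (ediam (U ik) <= (w ik.1)%:E)%E.
  apply: ediam_le => // p q [Sp /andP[p1 p2]] [Sq /andP[q1 q2]].
  apply: le_trans (hexp _ _ _ Sp Sq) _; rewrite ler_norml.
  move: p1 p2 q1 q2; rewrite -natr1 mulrDl mul1r => p1 p2 q1 q2.
  by apply/andP; split; lra.
have TU : T `<=` \bigcup_ik U ik.
  move=> p /TS[i _ Sp]; have /andP[h1 h2] := hinf i p Sp.
  have [wi0|wi0] := eqVneq (w i) 0.
    exists (i, ord0) => //; split => //=; rewrite wi0 !mulr0 addr0.
    have bi0 : b i = 0.
      by move/eqP: wi0; rewrite /w mulf_eq0 invr_eq0 (gt_eqF n0) orbF => /eqP.
    by rewrite h1 /=; move: h2; rewrite bi0 addr0.
  have wi : 0 < w i by rewrite lt_def wi0 w0.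
  have bw : b i = n.+1%:R * w i by rewrite /w mulrC divfK // gt_eqF.
  pose k := Num.truncn ((Psi i p - a i) / w i).
  have r0 : 0 <= (Psi i p - a i) / w i by rewrite divr_ge0 ?subr_ge0 // ltW.
  have /andP[k1 k2] := truncn_itv r0.
  rewrite -/k ler_pdivlMr // in k1; rewrite -/k ltr_pdivrMr // in k2.
  have [kn|kn] := ltnP k n.+1.
    by exists (i, Ordinal kn) => //; split => //=; apply/andP; split; lra.
  (* Here [Psi i p] is the right end [a i + b i], which belongs to the last slice. *)
  exists (i, ord_max) => //; split => //=.
  have : (n.+1%:R : R) * w i <= k%:R * w i by rewrite ler_wpM2r ?ler_nat.
  rewrite -bw => hk; apply/andP; split; last exact: h2.
  apply: le_trans (_ : a i + n.+1%:R * w i <= _); last by rewrite -bw; lra.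
  by rewrite lerD2l ler_wpM2r // ler_nat.
apply: le_trans (hausdorff1_pre_le_sum (ltW d0) TU _) _.
  by move=> ik; apply: le_trans (Ud ik) _; rewrite lee_fin; exact: hn.
rewrite -sumEFin.
rewrite -(pair_bigA _ (fun i (k : 'I_n.+1) => ediam (U (i, k)))) /=.
apply: lee_sum => i _.
apply: le_trans (_ : (\sum_(k < n.+1) (w i)%:E <= _)%E).
  by apply: lee_sum => k _; exact: Ud (i, k).
rewrite sumEFin sumr_const card_ord lee_fin -[leLHS]mulr_natr /w.
by rewrite divfK // gt_eqF.
Qed.

(** A set of diameter at most eta meets at most one piece [S i], so each covering set is charged
    only once. [w i] may be any countably subadditive quantity that stays below the diameter on
    subsets of [S i]. *)
Lemma hausdorff1_pre_ge_sum (R : realType) (I : finType)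
    (S : I -> set (R * R)) (w : I -> set (R * R) -> \bar R) (T : set (R * R))
    (eta : R) :
  (forall i, S i `<=` T) ->
  (forall i j p q, S i p -> S j q -> edist p q <= eta -> i = j) ->
  (forall i, w i set0 = 0%E) -> (forall i U, (0 <= w i U)%E) ->
  (forall i U, U `<=` S i -> (w i U <= ediam U)%E) ->
  (forall i (U : (set (R * R))^nat), S i = \bigcup_k U k ->
     (w i (S i) <= \sum_(0 <= k <oo) w i (U k))%E) ->
  (\sum_i w i (S i) <= hausdorff1_pre eta T)%E.
Proof.
move=> ST sep w0 wpos wle wsub; apply: le_ereal_inf_tmp => _ [U [TU Ueta] <-].
apply: le_trans (_ : (\sum_i \sum_(0 <= k <oo) w i (S i `&` U k) <= _)%E).
  apply: lee_sum => i _; apply: wsub; rewrite -setI_bigcupr.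
  by apply/seteqP; split=> p; [move=> Sp; split=> //; apply/TU/(ST i)|case].
rewrite -nneseries_sum //; apply: lee_nneseries => [k _ _|k _].
  by apply: sume_ge0 => i _.
have [[i [p [Sp Up]]]|none] := pselect (exists i, S i `&` U k !=set0).
  rewrite (bigD1 i) //= big1 ?adde0.
    apply: le_trans (wle i (S i `&` U k) (@subIsetl _ _ _)) _.
    apply: ge_ereal_sup => _ [->|[[q q'] [/= [_ Uq] [_ Uq']] <-]].
      exact: ediam_ge0.
    exact: edist_le_ediam.
  move=> j ji; rewrite (_ : S j `&` U k = set0) //.
  apply/seteqP; split=> // q [Sq Uq].
  move/eqP: ji; apply; apply: (sep j i q p) => //.
  by rewrite -lee_fin; apply: le_trans (Ueta k); exact: edist_le_ediam.
rewrite big1 ?ediam_ge0 // => i _; rewrite (_ : S i `&` U k = set0) //.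
by apply/seteqP; split=> // q Sq; apply: none; exists i, q.
Qed.

(** * Projections of decreasing chains *)

(** On an arbitrary set [lebesgue_measure] is the outer measure. Projections of covering sets are
    arbitrary, so the bounds on them rest on monotonicity and countable subadditivity alone. *)
Lemma le_lebesgue_outer (R : realType) (A B : set R) : A `<=` B ->
  (lebesgue_measure A <= lebesgue_measure B)%E.
Proof. by move=> AB; exact: le_mu_ext. Qed.

Lemma lebesgue_outer_ge0 (R : realType) (A : set R) :
  (0 <= lebesgue_measure A)%E.
Proof. exact: mu_ext_ge0. Qed.

Lemma lebesgue_outer_bigcup (R : realType) (U : (set R)^nat) :
  (lebesgue_measure (\bigcup_k U k) <= \sum_(0 <= k <oo) lebesgue_measure (U k))%E.
Proof. exact: mu_ext_sigma_subadditive. Qed.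

Lemma lebesgue_outer_le (R : realType) (D : set R) (c : R) : 0 <= c ->
  (forall x y, D x -> D y -> x - y <= c) -> (lebesgue_measure D <= c%:E)%E.
Proof.
move=> c0 h; have [->|/set0P[x Dx]] := eqVneq D set0.
  by rewrite measure0 lee_fin.
have hlb : has_inf D.
  by split; [exists x | exists (x - c) => y Dy; have := h x y Dx Dy; lra].
apply: (@le_trans _ _ (lebesgue_measure `[inf D, inf D + c]%classic)).
  apply: le_lebesgue_outer => y Dy /=; rewrite in_itv /= ge_inf //=; last by case: hlb.
  rewrite -lerBlDr; apply: lb_le_inf; first by exists x.
  by move=> z Dz; have := h y z Dy Dz; lra.
rewrite lebesgue_measure_itv /= lte_fin.
by case: ifP => _; rewrite -?EFinB lee_fin //; lra.
Qed.

(** Points with the same abscissa are not constrained, so vertical segments are allowed. *)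
Definition decreasing_chain (R : realType) (S : set (R * R)) : Prop :=
  forall p q, S p -> S q -> p.1 < q.1 -> q.2 <= p.2.

Lemma decreasing_chain_total (R : realType) (S : set (R * R)) (p q : R * R) :
  decreasing_chain S -> S p -> S q ->
  (p.1 <= q.1 /\ q.2 <= p.2) \/ (q.1 <= p.1 /\ p.2 <= q.2).
Proof.
move=> ch Sp Sq; case: (ltgtP p.1 q.1) => pq.
- by left; split=> //; exact: ch.
- by right; split=> //; exact: ch.
- by case: (leP p.2 q.2) => [h|/ltW h]; [right | left].
Qed.

Lemma le_edist1 (R : realType) (p q : R * R) : p.1 - q.1 <= edist p q.
Proof. by apply: le_edist; rewrite lerDl sqr_ge0. Qed.

Lemma le_edist2 (R : realType) (p q : R * R) : p.2 - q.2 <= edist p q.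
Proof. by apply: le_edist; rewrite lerDr sqr_ge0. Qed.

Lemma sqr_sqrt2 (R : realType) : (Num.sqrt 2 : R) ^+ 2 = 2.
Proof. by rewrite sqr_sqrtr. Qed.

Lemma sqrt2_gt0 (R : realType) : 0 < (Num.sqrt 2 : R).
Proof. by rewrite sqrtr_gt0. Qed.

(** Cauchy-Schwarz against the vector (1, -1). *)
Lemma le_sqrt2_edist (R : realType) (p q : R * R) :
  (p.1 - q.1) + (q.2 - p.2) <= Num.sqrt 2 * edist p q.
Proof.
rewrite -ler_pdivrMl ?sqrt2_gt0 //; apply: le_edist.
rewrite exprMn exprVn sqr_sqrt2 -subr_ge0.
apply: le_trans (_ : 0 <= 2^-1 * ((p.1 - q.1) - (q.2 - p.2)) ^+ 2) _.
  by rewrite mulr_ge0 ?invr_ge0 // sqr_ge0.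
by rewrite le_eqVlt; apply/orP; left; apply/eqP; field.
Qed.

Lemma lebesgue_fst_le_ediam (R : realType) (U : set (R * R)) :
  (lebesgue_measure (fst @` U) <= ediam U)%E.
Proof.
have := @ediam_ge0 R U; case E: (ediam U) => [d| |] // d0; last exact: leey.
apply: lebesgue_outer_le; first by rewrite -lee_fin.
move=> _ _ [p Up <-] [q Uq <-]; apply: le_trans (le_edist1 p q) _.
by rewrite -lee_fin -E; exact: edist_le_ediam.
Qed.

Lemma lebesgue_snd_le_ediam (R : realType) (U : set (R * R)) :
  (lebesgue_measure (snd @` U) <= ediam U)%E.
Proof.
have := @ediam_ge0 R U; case E: (ediam U) => [d| |] // d0; last exact: leey.
apply: lebesgue_outer_le; first by rewrite -lee_fin.
move=> _ _ [p Up <-] [q Uq <-]; apply: le_trans (le_edist2 p q) _.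
by rewrite -lee_fin -E; exact: edist_le_ediam.
Qed.

(** For a decreasing arc this is the length of its projection onto the antidiagonal. *)
Definition chain_width (R : realType) (U : set (R * R)) : \bar R :=
  ((Num.sqrt 2)^-1%:E *
    (lebesgue_measure (fst @` U) + lebesgue_measure (snd @` U)))%E.

(** In a chain a single pair of points dominates a horizontal and a vertical oscillation at once, so
    Cauchy-Schwarz bounds their sum. Hence the x-projection has measure at most sqrt 2 times the
    diameter minus any vertical oscillation; solving for the latter bounds the y-projection. *)
Lemma chain_width_le_ediam (R : realType) (U : set (R * R)) :
  decreasing_chain U -> (chain_width U <= ediam U)%E.
Proof.
move=> ch; have := @ediam_ge0 R U; rewrite /chain_width.
case E: (ediam U) => [d| |] // d0; last exact: leey.
rewrite lee_pdivrMl ?sqrt2_gt0 //.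
rewrite lee_fin in d0.
have H p q : U p -> U q -> (p.1 - q.1) + (q.2 - p.2) <= Num.sqrt 2 * d.
  move=> Up Uq; apply: le_trans (le_sqrt2_edist p q) _.
  rewrite ler_pM2l ?sqrt2_gt0 // -lee_fin -E; exact: edist_le_ediam.
(* Replace p and q by the one that comes first along the chain, p' and q' by the one that comes
   last. *)
have K p p' q q' : U p -> U p' -> U q -> U q' ->
    (p'.1 - p.1) + (q.2 - q'.2) <= Num.sqrt 2 * d.
  move=> Up Up' Uq Uq'.
  case: (decreasing_chain_total ch Up Uq) => -[h1 h2];
  case: (decreasing_chain_total ch Up' Uq') => -[h3 h4].
  - by have := H q' p Uq' Up; lra.
  - by have := H p' p Up' Up; lra.
  - by have := H q' q Uq' Uq; lra.
  - by have := H p' q Up' Uq; lra.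
have [U0|/set0P[p0 Up0]] := eqVneq U set0.
  by rewrite U0 !image_set0 !measure0 adde0 lee_fin mulr_ge0 // ltW // sqrt2_gt0.
have hx q q' : U q -> U q' ->
    (lebesgue_measure (fst @` U) <= (Num.sqrt 2 * d - (q.2 - q'.2))%:E)%E.
  move=> Uq Uq'; apply: lebesgue_outer_le.
    by have := K p0 p0 q q' Up0 Up0 Uq Uq'; lra.
  by move=> _ _ [p Up <-] [p' Up' <-]; have := K p' p q q' Up' Up Uq Uq'; lra.
have := @lebesgue_outer_ge0 R (fst @` U); have := hx p0 p0 Up0 Up0.
case Ex : (lebesgue_measure (fst @` U)) => [l| |] // hl l0.
rewrite -leeBrDl // -EFinB; apply: lebesgue_outer_le.
  by move: hl; rewrite lee_fin; lra.
move=> _ _ [q Uq <-] [q' Uq' <-].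
by have := hx q q' Uq Uq'; rewrite Ex lee_fin; lra.
Qed.

Lemma lebesgue_image_bigcup (R : realType) (f : R * R -> R)
    (U : (set (R * R))^nat) :
  (lebesgue_measure (f @` \bigcup_k U k)
    <= \sum_(0 <= k <oo) lebesgue_measure (f @` U k))%E.
Proof. by rewrite image_bigcup; exact: lebesgue_outer_bigcup. Qed.

Lemma chain_width_bigcup (R : realType) (U : (set (R * R))^nat) :
  (chain_width (\bigcup_k U k) <= \sum_(0 <= k <oo) chain_width (U k))%E.
Proof.
rewrite nneseriesZl; last by move=> k _; rewrite adde_ge0 // lebesgue_outer_ge0.
rewrite nneseriesD; try by move=> k _ _; exact: lebesgue_outer_ge0.
rewrite lee_wpmul2l ?lee_fin ?invr_ge0 ?sqrtr_ge0 //.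
by rewrite leeD // lebesgue_image_bigcup.
Qed.

Lemma chain_width_ge0 (R : realType) (U : set (R * R)) : (0 <= chain_width U)%E.
Proof.
by rewrite mule_ge0 ?lee_fin ?invr_ge0 ?sqrtr_ge0 // adde_ge0 // lebesgue_outer_ge0.
Qed.

(** * Level curves of a copula *)

(** Retraction of the line onto [0, 1]. Composing a copula with it in both coordinates keeps the
    values on the square and extends monotonicity, the rectangle inequality and the Lipschitz bounds
    to the whole plane, so that no range conditions have to be carried along. *)
Definition clamp (R : realType) (x : R) : R := Num.max 0 (Num.min x 1).

Definition clamped (R : realType) (A : R * R -> R) (p : R * R) : R :=
  A (clamp p.1, clamp p.2).

Record plane_copula (R : realType) (A : R * R -> R) : Prop := PlaneCopula {
  pc_bot1 : forall y, A (0, y) = 0;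
  pc_bot2 : forall x, A (x, 0) = 0;
  pc_top1 : forall y, 0 <= y <= 1 -> A (1, y) = y;
  pc_top2 : forall x, 0 <= x <= 1 -> A (x, 1) = x;
  pc_incr : forall x1 x2 y1 y2, x1 <= x2 -> y1 <= y2 ->
    A (x2, y1) + A (x1, y2) <= A (x2, y2) + A (x1, y1);
  pc_mono1 : forall x1 x2 y, x1 <= x2 -> A (x1, y) <= A (x2, y);
  pc_mono2 : forall x y1 y2, y1 <= y2 -> A (x, y1) <= A (x, y2);
  pc_lip1 : forall x1 x2 y, x1 <= x2 -> A (x2, y) - A (x1, y) <= x2 - x1;
  pc_lip2 : forall x y1 y2, y1 <= y2 -> A (x, y2) - A (x, y1) <= y2 - y1 }.

Lemma clamp_itv (R : realType) (x : R) : 0 <= clamp x <= 1.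
Proof. by rewrite /clamp le_max lexx /= ge_max ler01 ge_min lexx orbT. Qed.

Lemma clamp_id (R : realType) (x : R) : 0 <= x <= 1 -> clamp x = x.
Proof. by move=> /andP[h1 h2]; rewrite /clamp (min_idPl h2) (max_idPr h1). Qed.

Lemma clamp_le (R : realType) (x y : R) : x <= y -> clamp x <= clamp y.
Proof.
by move=> h; rewrite /clamp /Num.max /Num.min; repeat case: ifPn; rewrite -?leNgt; lra.
Qed.

Lemma clamp_lip (R : realType) (x y : R) :
  x <= y -> clamp y - clamp x <= y - x.
Proof.
by move=> h; rewrite /clamp /Num.max /Num.min; repeat case: ifPn; rewrite -?leNgt; lra.
Qed.

(** Monotonicity is the rectangle inequality with one side on an axis, where A vanishes; the
    Lipschitz bounds come from rectangles with one side on the opposite edge, where A is the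
    identity. *)
Lemma plane_copula_clamped (R : realType) (A : R * R -> R) :
  copula A -> plane_copula (clamped A).
Proof.
move=> [bot top incr]; rewrite /clamped.
have c0 : clamp (0 : R) = 0 by rewrite clamp_id // lexx ler01.
have c1 : clamp (1 : R) = 1 by rewrite clamp_id // lexx ler01.
have cI x : clamp x \in `[(0 : R), 1] by rewrite in_itv; exact: clamp_itv.
have cg (x : R) : 0 <= clamp x by case/andP: (clamp_itv x).
have cl (x : R) : clamp x <= 1 by case/andP: (clamp_itv x).
have inc x1 x2 y1 y2 : x1 <= x2 -> y1 <= y2 ->
    0 <= A (clamp x2, clamp y2) - A (clamp x2, clamp y1)
         - A (clamp x1, clamp y2) + A (clamp x1, clamp y1).
  by move=> hx hy; apply: incr => //; exact: clamp_le.
have inc0 x1 x2 y : x1 <= x2 -> 0 <= A (clamp x2, clamp y) - A (clamp x1, clamp y).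
  move=> h; have [b1 _] := bot _ (cI x1); have [b2 _] := bot _ (cI x2).
  by have := incr _ _ 0 _ (cg x1) (clamp_le h) (cl x2) (lexx 0) (cg y) (cl y); lra.
have inc0' y1 y2 x : y1 <= y2 -> 0 <= A (clamp x, clamp y2) - A (clamp x, clamp y1).
  move=> h; have [_ b1] := bot _ (cI y1); have [_ b2] := bot _ (cI y2).
  by have := incr 0 _ _ _ (lexx 0) (cg x) (cl x) (cg y1) (clamp_le h) (cl y2); lra.
split=> /=.
- by move=> y; rewrite c0; case: (bot _ (cI y)).
- by move=> x; rewrite c0; case: (bot _ (cI x)).
- by move=> y hy; rewrite c1; case: (top _ (cI y)) => _ ->; rewrite clamp_id.
- by move=> y hy; rewrite c1; case: (top _ (cI y)) => -> _; rewrite clamp_id.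
- by move=> x1 x2 y1 y2 hx hy; have := inc _ _ _ _ hx hy; lra.
- by move=> x1 x2 y hx; have := inc0 _ _ y hx; lra.
- by move=> x y1 y2 hy; have := inc0' _ _ x hy; lra.
- move=> x1 x2 y hx; apply: le_trans (clamp_lip hx).
  have [b1 _] := top _ (cI x1); have [b2 _] := top _ (cI x2).
  by have := incr _ _ _ 1 (cg x1) (clamp_le hx) (cl x2) (cg y) (cl y) (lexx 1); lra.
- move=> x y1 y2 hy; apply: le_trans (clamp_lip hy).
  have [_ b1] := top _ (cI y1); have [_ b2] := top _ (cI y2).
  by have := incr _ 1 _ _ (cg x) (cl x) (lexx 1) (cg y1) (clamp_le hy) (cl y2); lra.
Qed.

Lemma clamped_id (R : realType) (A : R * R -> R) (p : R * R) :
  unit_square p -> clamped A p = A p.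
Proof.
case: p => x y [/=]; rewrite /unit_itv /= !in_itv /= => hx hy.
by rewrite /clamped /= !clamp_id.
Qed.

Lemma length_measure_clamped (R : realType) (A : R * R -> R) :
  length_measure (clamped A) = length_measure A.
Proof.
apply: eq_integral => t _; rewrite /level_length /level_boundary.
rewrite (_ : upper_level (clamped A) t = upper_level A t) //.
by apply/seteqP; split=> p [/set_mem Sp h]; split; rewrite ?inE //;
  rewrite clamped_id // in h *.
Qed.

Section LevelBoundary.
Variables (R : realType) (A : R * R -> R) (t : R).
Hypothesis HA : plane_copula A.

Lemma pc_lip (x1 x2 y1 y2 : R) : x1 <= x2 -> y1 <= y2 ->
  A (x2, y2) - A (x1, y1) <= (x2 - x1) + (y2 - y1).
Proof.
move=> hx hy.
by have := pc_lip1 HA y2 hx; have := pc_lip2 HA x1 hy; lra.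
Qed.

Lemma pc_mono (x1 x2 y1 y2 : R) : x1 <= x2 -> y1 <= y2 ->
  A (x1, y1) <= A (x2, y2).
Proof. by move=> hx hy; exact: le_trans (pc_mono1 HA y1 hx) (pc_mono2 HA x2 hy). Qed.

Lemma level_boundary_square p : level_boundary A t p ->
  (0 < p.1 < 1) /\ (0 < p.2 < 1).
Proof. by case=> _ [/=]; rewrite !in_itv. Qed.

Lemma level_boundary_ge p : level_boundary A t p -> t <= A p.
Proof.
case: p => x y [[cl _] _]; rewrite leNgt; apply/negP => lt.
have e0 : 0 < (t - A (x, y)) / 2 by lra.
have [[x' y'] [[_ /= hA]]] := cl _ (nbhsx_ballx (x, y) _ e0).
case=> /=; rewrite /ball /= !ltr_norml => /andP[b1 b2] /andP[b3 b4].
(* The Lipschitz bound compares ordered points, so the two points are related through their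
   coordinatewise maximum. *)
have := @pc_mono x' (Num.max x x') y' (Num.max y y').
rewrite !le_max !lexx !orbT => /(_ erefl erefl) h1.
have := @pc_lip x (Num.max x x') y (Num.max y y').
rewrite !le_max !lexx => /(_ erefl erefl) h2.
have : Num.max x x' - x < (t - A (x, y)) / 2.
  by rewrite /Num.max; case: ifP; lra.
have : Num.max y y' - y < (t - A (x, y)) / 2.
  by rewrite /Num.max; case: ifP; lra.
lra.
Qed.

(** If a point strictly to the south-west reached the level t, so would the whole quadrant above it,
    which is a neighbourhood of p within the square. *)
Lemma level_boundary_lt p x y : level_boundary A t p -> x < p.1 -> y < p.2 ->
  A (x, y) < t.
Proof.
move=> bp hx hy; rewrite ltNge; apply/negP => le.
have [/andP[p10 p11] /andP[p20 p21]] := level_boundary_square bp.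
case: bp => -[_ ni] _; apply: ni.
(* Taking the maximum with 0 keeps the quadrant inside the unit square. *)
pose x' := Num.max x 0; pose y' := Num.max y 0.
have hle : t <= A (x', y').
  by apply: le_trans le _; apply: pc_mono; rewrite le_max lexx.
have hx' : x' < p.1 by rewrite gt_max hx.
have hy' : y' < p.2 by rewrite gt_max hy.
have x'0 : 0 <= x' by rewrite le_max lexx orbT.
have y'0 : 0 <= y' by rewrite le_max lexx orbT.
exists (`]x', 1[%classic, `]y', 1[%classic) => /=.
  by split; apply: open_nbhs_nbhs; split => //=; rewrite in_itv /= ?hx' ?hy'.
move=> q [/=]; rewrite !in_itv /= => /andP[q1 q2] /andP[q3 q4].
split; last first.
  apply: le_trans hle _; case: q q1 q2 q3 q4 => ? ? /= *.
  by apply: pc_mono; exact: ltW.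
rewrite inE /unit_square /unit_itv; split => /=; rewrite in_itv /=; lra.
Qed.

(** Stepping back by e in both coordinates lowers A by at most 2 e, so a value above t would
    contradict [level_boundary_lt]. *)
Lemma level_boundary_eq p : level_boundary A t p -> A p = t.
Proof.
move=> bp; apply/eqP; rewrite eq_le level_boundary_ge // andbT.
rewrite leNgt; apply/negP => gt.
pose e := (A p - t) / 2; have e0 : 0 < e by rewrite /e; lra.
have := @level_boundary_lt p (p.1 - e) (p.2 - e) bp.
rewrite !ltrBlDr !ltrDl => /(_ e0 e0).
have := @pc_lip (p.1 - e) p.1 (p.2 - e) p.2.
rewrite -surjective_pairing; have : e + e = A p - t by rewrite /e; field.
lra.
Qed.

Lemma level_boundary_chain : decreasing_chain (level_boundary A t).
Proof.
move=> p q bp bq pq1; rewrite leNgt; apply/negP => pq2.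
have := level_boundary_lt bq pq1 pq2.
by rewrite -surjective_pairing (level_boundary_eq bp) ltxx.
Qed.

(** Points just below (x, y) on the vertical line leave the level set, so (x, y) is not interior.
    This produces points of the level curve over a given abscissa. *)
Lemma level_boundaryP2 x y : 0 < x < 1 -> 0 < y < 1 -> t <= A (x, y) ->
  (forall y', y' < y -> A (x, y') < t) -> level_boundary A t (x, y).
Proof.
move=> hx hy tA lt.
have sq : unit_square (x, y).
  by rewrite /unit_square /unit_itv; split => /=; rewrite in_itv /=; lra.
split; last by split; rewrite /= in_itv.
split; first by apply: subset_closure; split; rewrite ?inE.
move=> /nbhs_ballP[e /= e0 be].
have : upper_level A t (x, y - e / 2).
  by apply: be; split => /=; rewrite /ball /= ltr_norml; lra.
by case=> _ /=; rewrite leNgt lt // ltrBlDr ltrDl divr_gt0.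
Qed.

Lemma level_boundaryP1 x y : 0 < x < 1 -> 0 < y < 1 -> t <= A (x, y) ->
  (forall x', x' < x -> A (x', y) < t) -> level_boundary A t (x, y).
Proof.
move=> hx hy tA lt.
have sq : unit_square (x, y).
  by rewrite /unit_square /unit_itv; split => /=; rewrite in_itv /=; lra.
split; last by split; rewrite /= in_itv.
split; first by apply: subset_closure; split; rewrite ?inE.
move=> /nbhs_ballP[e /= e0 be].
have : upper_level A t (x - e / 2, y).
  by apply: be; split => /=; rewrite /ball /= ltr_norml; lra.
by case=> _ /=; rewrite leNgt lt // ltrBlDr ltrDl divr_gt0.
Qed.

End LevelBoundary.

(** * Integration over the levels *)

Section Strip.
Variable R : realType.
Local Notation lam := (@lebesgue_measure R).

(** A level section of the region between the graphs of f and g. By Tonelli its integral over t is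
    that of g - f over ]a, b], as long as f and g take values in [0, 1]. *)
Definition strip (a b : R) (f g : R -> R) (t : R) : \bar R :=
  lam [set x | a < x <= b /\ f x < t <= g x].

Variables (a b : R) (f g : R -> R).
Hypotheses (fnd : {homo f : x y / x <= y}) (gnd : {homo g : x y / x <= y}).

(** The first coordinate is the level t, the second the point x. *)
Let D : set (measurableTypeR R * measurableTypeR R) :=
  [set p | 0 < p.1 < 1] `&` ([set p | a < p.2 <= b] `&`
  ([set p | f p.2 < p.1] `&` [set p | p.1 <= g p.2])).

Let measurable_D : measurable D.
Proof.
have m1 : measurable_fun setT (fst : R * R -> R) by exact: measurable_fst.
have m2 : measurable_fun setT (snd : R * R -> R) by exact: measurable_snd.
have mf : measurable_fun setT (f \o (snd : R * R -> R)).
  by apply: measurableT_comp => //; apply: nondecreasing_measurable.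
have mg : measurable_fun setT (g \o (snd : R * R -> R)).
  by apply: measurableT_comp => //; apply: nondecreasing_measurable.
have bset (h : R * R -> bool) : measurable_fun setT h -> measurable [set p | h p].
  by move=> mh; rewrite -[X in measurable X]setTI; apply: (mh measurableT [set true]).
apply: measurableI; [|apply: measurableI; [|apply: measurableI]].
- apply: bset; apply: measurable_and.
    exact: measurable_fun_ltr.
  exact: measurable_fun_ltr.
- apply: bset; apply: measurable_and.
    exact: measurable_fun_ltr.
  exact: measurable_fun_ler.
- by apply: bset; exact: measurable_fun_ltr.
- by apply: bset; exact: measurable_fun_ler.
Qed.

Let strip_xsection (t : R) : 0 < t < 1 -> strip a b f g t = lam (xsection D t).
Proof.
move=> t01; congr (lam _); apply/seteqP; split=> x /=.
  move=> [hx /andP[h1 h2]]; rewrite /xsection /= inE; split => //.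
by rewrite /xsection /= inE => -[_ [/= hx [/= h1 h2]]]; rewrite h1 h2.
Qed.

Lemma measurable_strip : measurable_fun (`]0, 1[%classic : set R) (strip a b f g).
Proof.
apply: (eq_measurable_fun (lam \o xsection D)).
  by move=> t; rewrite inE /= in_itv => t01; rewrite strip_xsection.
apply: measurable_funS (measurable_fun_xsection _ _) => //.
Qed.

Lemma integral_strip :
  (\int[lam]_(t in `]0%R, 1%R[) strip a b f g t =
   \int[lam]_x lam (ysection D x))%E.
Proof.
have := @indic_fubini_tonelli _ _ _ _ _ lam lam D measurable_D.
rewrite indic_fubini_tonelli_FE // indic_fubini_tonelli_GE // => <-.
rewrite integral_mkcond; apply: eq_integral => t _ /=.
rewrite patchE; case: ifPn; rewrite ?notin_setE ?inE /= in_itv => t01.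
  by rewrite strip_xsection.
rewrite (_ : xsection D t = set0) ?measure0 //.
by apply/seteqP; split=> // x; rewrite /xsection /= inE => -[].
Qed.

Lemma integral_strip_le (c : R) : a <= b -> 0 <= c ->
  (forall x, a < x <= b -> g x - f x <= c) ->
  (\int[lam]_(t in `]0%R, 1%R[) strip a b f g t <= ((b - a) * c)%:E)%E.
Proof.
move=> ab c0 h; rewrite integral_strip.
apply: (@le_trans _ _ (\int[lam]_(x in `]a, b]) (cst c%:E x))%E).
  rewrite [leRHS]integral_mkcond; apply: ge0_le_integral => //.
  - exact: measurable_fun_ysection.
  - by apply/(measurable_restrictT _ _).1.
  - move=> x _; rewrite patchE; case: ifPn; rewrite ?notin_setE ?inE /= in_itv => hx.
      apply: lebesgue_outer_le => // s t; rewrite /ysection /= !inE.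
      move=> -[_ [_ [/= h1 h2]]] [_ [_ [/= h3 h4]]].
      by have := h x hx; lra.
    rewrite (_ : ysection D x = set0) ?measure0 //.
    by apply/seteqP; split=> // t; rewrite /ysection /= inE => -[_ []].
rewrite integral_cst //= lebesgue_measure_itv /= lte_fin.
case: ltP => [_|ba]; first by rewrite -EFinB -EFinM lee_fin mulrC.
by rewrite mule0 lee_fin mulr_ge0 // subr_ge0.
Qed.

(** The bounds on f and g keep every level between f x and g x inside ]0, 1[, so the integral loses
    none. *)
Lemma integral_strip_ge (c : R) : a <= b -> 
  (forall x, a < x <= b -> 0 <= f x) -> (forall x, a < x <= b -> g x <= 1) ->
  (forall x, a < x <= b -> c <= g x - f x) ->
  (((b - a) * c)%:E <= \int[lam]_(t in `]0%R, 1%R[) strip a b f g t)%E.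
Proof.
move=> ab f0 g1 h.
have [c0|c0] := ltP c 0.
  apply: (@le_trans _ _ 0%E).
    by rewrite lee_fin mulr_ge0_le0 // ?subr_ge0 // ltW.
  by apply: integral_ge0 => t _; exact: lebesgue_outer_ge0.
rewrite integral_strip.
apply: (@le_trans _ _ (\int[lam]_(x in `]a, b]) (cst c%:E x))%E).
  rewrite integral_cst //= lebesgue_measure_itv /= lte_fin.
  case: ltP => [_|ba]; first by rewrite -EFinB -EFinM lee_fin mulrC.
  by rewrite mule0 lee_fin (_ : b - a = 0) ?mul0r //; lra.
rewrite [leLHS]integral_mkcond; apply: ge0_le_integral => //.
- by move=> x _; rewrite patchE; case: ifPn; rewrite lee_fin.
- by apply/(measurable_restrictT _ _).1.
- exact: measurable_fun_ysection.
- move=> x _; rewrite patchE; case: ifPn => [|_]; last exact: lebesgue_outer_ge0.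
  rewrite inE /= in_itv => hx.
  apply: (@le_trans _ _ (lam `]f x, g x[%classic)).
    rewrite lebesgue_measure_itv /= lte_fin; have := h x hx.
    by case: ltP => [_|ba] hc; rewrite -?EFinB lee_fin //; lra.
  apply: le_lebesgue_outer => t /=; rewrite in_itv /ysection /= inE => ht.
  by have := f0 x hx; have := g1 x hx; do !split => //=; lra.
Qed.

End Strip.

(** * Upper bound on a cell *)

(** For nonnegative functions the integral is a supremum over the simple functions below, hence
    monotone without measurability. This lets the length of a level curve be compared with
    measurable bounds directly. *)
Lemma le_ge0_integral (d : measure_display) (T : measurableType d)
    (R : realType) (mu : {measure set T -> \bar R}) (D : set T)
    (f g : T -> \bar R) :
  (forall x, D x -> (0 <= f x <= g x)%E) ->
  (\int[mu]_(x in D) f x <= \int[mu]_(x in D) g x)%E.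
Proof.
move=> fg; rewrite !ge0_integralE; try by
  move=> x Dx; case/andP: (fg x Dx) => h1 h2 //; exact: le_trans h2.
apply: ereal_sup_le => _ [h hf <-]; exists h => // x.
apply: le_trans (hf x) _; rewrite !patchE; case: ifPn => //.
by rewrite inE => /fg /andP[].
Qed.

Section Cell.
Variables (R : realType) (A : R * R -> R) (HA : plane_copula A).
Variables (x0 x1 y0 y1 : R).
Hypotheses (x01 : x0 <= x1) (y01 : y0 <= y1).
Local Notation lam := (@lebesgue_measure R).

Definition cell_trace (t : R) : set (R * R) :=
  level_boundary A t `&` [set p | x0 < p.1 <= x1 /\ y0 < p.2 <= y1].

(** Measures the abscissae at which A passes the level t between the heights y0 and y1; it plays the
    role of the x-projection of the level curve in the cell. *)
Definition cell_width (t : R) : \bar R :=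
  strip x0 x1 (fun x => A (x, y0)) (fun x => A (x, y1)) t.

Definition cell_height (t : R) : \bar R :=
  strip y0 y1 (fun y => A (x0, y)) (fun y => A (x1, y)) t.

(* Vanishes iff A(x, y) - A(x0, y0) = (x - x0) + (y - y0) on the cell. *)
Definition cell_defect : R :=
  ((x1 - x0) - (A (x1, y0) - A (x0, y0))) +
  ((y1 - y0) - (A (x0, y1) - A (x0, y0))).

Lemma cell_width_bound t : (0 <= cell_width t <= (x1 - x0)%:E)%E.
Proof.
rewrite lebesgue_outer_ge0 /=; apply: lebesgue_outer_le; first by rewrite subr_ge0.
by move=> x y [hx _] [hy _]; lra.
Qed.

Lemma cell_height_bound t : (0 <= cell_height t <= (y1 - y0)%:E)%E.
Proof.
rewrite lebesgue_outer_ge0 /=; apply: lebesgue_outer_le; first by rewrite subr_ge0.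
by move=> x y [hx _] [hy _]; lra.
Qed.

Lemma cell_width_fin t : cell_width t = (fine (cell_width t))%:E.
Proof.
have /andP[h0 h1] := cell_width_bound t; rewrite fineK // ge0_fin_numE //.
exact: le_lt_trans h1 (ltry _).
Qed.

Lemma cell_height_fin t : cell_height t = (fine (cell_height t))%:E.
Proof.
have /andP[h0 h1] := cell_height_bound t; rewrite fineK // ge0_fin_numE //.
exact: le_lt_trans h1 (ltry _).
Qed.

(** Each x strictly between q and p is counted: (x, y0) is strictly south-west of p, so A is below t
    there, while (x, y1) dominates q, where A equals t. *)
Lemma cell_trace_width t p q : cell_trace t p -> cell_trace t q ->
  p.1 - q.1 <= fine (cell_width t).
Proof.
move=> [bp [/andP[p1 p2] /andP[p3 p4]]] [bq [/andP[q1 q2] /andP[q3 q4]]].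
rewrite -lee_fin -cell_width_fin.
have [pq|pq] := leP p.1 q.1.
  apply: le_trans (lebesgue_outer_ge0 _); rewrite lee_fin; lra.
apply: (@le_trans _ _ (lam `]q.1, p.1[%classic)).
  by rewrite lebesgue_measure_itv /= lte_fin pq -EFinB.
apply: le_lebesgue_outer => x /=; rewrite in_itv /= => /andP[h1 h2].
split; first lra.
rewrite (level_boundary_lt HA bp h2 p3) /=.
rewrite -(level_boundary_eq HA bq) [q]surjective_pairing.
by apply: pc_mono => //=; exact: ltW.
Qed.

Lemma cell_trace_height t p q : cell_trace t p -> cell_trace t q ->
  p.2 - q.2 <= fine (cell_height t).
Proof.
move=> [bp [/andP[p1 p2] /andP[p3 p4]]] [bq [/andP[q1 q2] /andP[q3 q4]]].
rewrite -lee_fin -cell_height_fin.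
have [pq|pq] := leP p.2 q.2.
  apply: le_trans (lebesgue_outer_ge0 _); rewrite lee_fin; lra.
apply: (@le_trans _ _ (lam `]q.2, p.2[%classic)).
  by rewrite lebesgue_measure_itv /= lte_fin pq -EFinB.
apply: le_lebesgue_outer => y /=; rewrite in_itv /= => /andP[h1 h2].
split; first lra.
rewrite (level_boundary_lt HA bp p1 h2) /=.
rewrite -(level_boundary_eq HA bq) [q]surjective_pairing.
by apply: pc_mono => //=; exact: ltW.
Qed.

Lemma cell_trace_chain t : decreasing_chain (cell_trace t).
Proof. by move=> p q [bp _] [bq _]; exact: level_boundary_chain bp bq. Qed.

Lemma cell_trace_range t p : cell_trace t p -> A (x0, y0) < t <= A (x1, y1).
Proof.
move=> [bp [/andP[p1 p2] /andP[p3 p4]]].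
rewrite (level_boundary_lt HA bp p1 p3) /=.
by rewrite -(level_boundary_eq HA bp) [p]surjective_pairing; apply: pc_mono.
Qed.

(** Along a chain the increments of x and y have opposite signs, so x - y expands distances. *)
Lemma edist_chain_le (p q : R * R) (t : R) : cell_trace t p -> cell_trace t q ->
  edist p q <= `|(p.1 - p.2) - (q.1 - q.2)|.
Proof.
move=> Sp Sq; apply: edist_le => //; rewrite real_normK ?num_real //.
have : (p.1 - q.1) * (p.2 - q.2) <= 0.
  by case: (decreasing_chain_total (@cell_trace_chain t) Sp Sq) => -[h1 h2]; nra.
nra.
Qed.

(** Moving right and down along a curve by (dx, -dy) increases this by (dx + dy + D1 + D2) / sqrt 2,
    where D1 and D2 are the variations of the two correcting functions. *)
Definition drift (p : R * R) : R :=
  (p.1 - p.2 + (p.1 - A (p.1, y0)) - (p.2 - A (x0, p.2))) / Num.sqrt 2.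

(* Along the curve the two increments differ at most by the increments of the
   nondecreasing functions x - A(x, y0) and y - A(x0, y). *)
Lemma edist_drift_le (p q : R * R) (t : R) : cell_trace t p -> cell_trace t q ->
  edist p q <= `|drift p - drift q|.
Proof.
wlog [pq1 pq2] : p q / p.1 <= q.1 /\ q.2 <= p.2.
  move=> W Sp Sq.
  case: (decreasing_chain_total (@cell_trace_chain t) Sp Sq) => h; first exact: W.
  rewrite (_ : edist p q = edist q p); first by rewrite distrC; exact: W.
  by rewrite /edist; congr Num.sqrt; ring.
move=> [bp [/andP[p1 p2] /andP[p3 p4]]] [bq [/andP[q1 q2] /andP[q3 q4]]].
have Ep := level_boundary_eq HA bp; have Eq := level_boundary_eq HA bq.
rewrite [p]surjective_pairing in Ep; rewrite [q]surjective_pairing in Eq.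
have i1 := pc_incr HA pq1 (ltW q3).
have i2 := pc_incr HA (ltW p1) pq2.
have l1 := pc_lip1 HA q.2 pq1; have l2 := pc_lip2 HA p.1 pq2.
have l3 := pc_lip1 HA y0 pq1; have l4 := pc_lip2 HA x0 pq2.
apply: edist_le => //; rewrite real_normK ?num_real // /drift -mulrBl exprMn exprVn.
rewrite sqr_sqrt2 ler_pdivlMr // -subr_ge0.
set D1 := (q.1 - A (q.1, y0)) - (p.1 - A (p.1, y0)).
set D2 := (p.2 - A (x0, p.2)) - (q.2 - A (x0, q.2)).
set dx := q.1 - p.1; set dy := p.2 - q.2.
(* The increment of A along the lower edge is at most that at height q.2, which equals the vertical
   increment A(p.1, p.2) - A(p.1, q.2) because p and q lie on the same level; the latter is at most
   dy. *)
have h1 : dx - dy <= D1 by rewrite /D1 /dx /dy; lra.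
have h2 : dy - dx <= D2 by rewrite /D2 /dx /dy; lra.
have h3 : 0 <= D1 by rewrite /D1; lra.
have h4 : 0 <= D2 by rewrite /D2; lra.
have h5 : 0 <= dx by rewrite /dx; lra.
have h6 : 0 <= dy by rewrite /dy; lra.
rewrite [X in 0 <= X](_ : _ =
  (dx + dy + D1 + D2) ^+ 2 - (dx ^+ 2 + dy ^+ 2) * 2); last first.
  by rewrite /dx /dy /D1 /D2; ring.
(* With E = D1 + D2 >= |dx - dy|, the square of dx + dy + E is at least (dx + dy)^2 + (dx - dy)^2 =
   2 (dx^2 + dy^2). *)
have k1 : 0 <= (D1 + D2 - (dx - dy)) * (D1 + D2 + (dx - dy)).
  by apply: mulr_ge0; lra.
have k2 : 0 <= (dx + dy) * (D1 + D2) by apply: mulr_ge0; lra.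
nra.
Qed.

Lemma drift_osc (p q : R * R) (t : R) : cell_trace t p -> cell_trace t q ->
  drift p - drift q <=
  (fine (cell_width t) + fine (cell_height t) + cell_defect) / Num.sqrt 2.
Proof.
move=> Sp Sq; have wd := cell_trace_width Sp Sq; have ht := cell_trace_height Sq Sp.
move: Sp Sq => [bp [/andP[p1 p2] /andP[p3 p4]]] [bq [/andP[q1 q2] /andP[q3 q4]]].
rewrite /drift -mulrBl ler_wpM2r ?invr_ge0 ?sqrtr_ge0 // /cell_defect.
have := pc_lip1 HA y0 p2; have := pc_lip1 HA y0 (ltW q1).
have := pc_lip2 HA x0 q4; have := pc_lip2 HA x0 (ltW p3).
lra.
Qed.

End Cell.

Section CellBound.
Variables (R : realType) (A : R * R -> R) (HA : plane_copula A).
Variables (x0 x1 y0 y1 : R).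
Hypotheses (x01 : x0 <= x1) (y01 : y0 <= y1).
Local Notation lam := (@lebesgue_measure R).
Local Notation X := (cell_width A x0 x1 y0 y1).
Local Notation Y := (cell_height A x0 x1 y0 y1).
Local Notation k := (cell_defect A x0 x1 y0 y1).

Definition cell_range : set R := `]A (x0, y0), A (x1, y1)]%classic.

Lemma cell_defect_ge0 : 0 <= k.
Proof.
rewrite /cell_defect; have := pc_lip1 HA y0 x01; have := pc_lip2 HA x0 y01; lra.
Qed.

(** [b] selects the refined estimate. The indicator charges the defect only to levels that can meet
    the cell, so that integration multiplies it by the small difference of A between opposite
    corners. *)
Definition cell_bound (b : bool) (t : R) : \bar R :=
  (if b then (Num.sqrt 2)^-1%:E * (X t + Y t + (k * \1_cell_range t)%:E)
   else X t + Y t)%E.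

Lemma cell_bound_fin b t : exists2 r : R, 0 <= r & cell_bound b t = r%:E.
Proof.
have /andP[w0 _] := cell_width_bound A y0 y1 x01 t.
have /andP[h0 _] := cell_height_bound A x0 x1 y01 t.
rewrite /cell_bound (cell_width_fin A y0 y1 x01) (cell_height_fin A x0 x1 y01).
have w : 0 <= fine (X t) by exact: fine_ge0.
have h : 0 <= fine (Y t) by exact: fine_ge0.
case: b; last by exists (fine (X t) + fine (Y t)); rewrite ?addr_ge0.
exists ((Num.sqrt 2)^-1 * (fine (X t) + fine (Y t) + k * \1_cell_range t)) => //.
by rewrite mulr_ge0 ?invr_ge0 ?sqrtr_ge0 // !addr_ge0 // mulr_ge0 ?cell_defect_ge0.
Qed.

Lemma cell_bound_osc b t : exists Psi : R * R -> R, forall p q,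
  cell_trace A x0 x1 y0 y1 t p -> cell_trace A x0 x1 y0 y1 t q ->
  edist p q <= `|Psi p - Psi q| /\ ((Psi p - Psi q)%:E <= cell_bound b t)%E.
Proof.
case: b.
  exists (drift A x0 y0) => p q Sp Sq; split; first exact: edist_drift_le Sp Sq.
  rewrite /cell_bound (cell_width_fin A y0 y1 x01) (cell_height_fin A x0 x1 y01).
  rewrite indicE mem_set; last first.
    by rewrite /cell_range /= in_itv; exact: cell_trace_range Sp.
  by rewrite mulr1 -!EFinD -EFinM lee_fin mulrC; exact: drift_osc Sp Sq.
exists (fun p => p.1 - p.2) => p q Sp Sq; split; first exact: edist_chain_le Sp Sq.
rewrite /cell_bound (cell_width_fin A y0 y1 x01) (cell_height_fin A x0 x1 y01).
rewrite -EFinD lee_fin.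
have := cell_trace_width HA x01 Sp Sq; have := cell_trace_height HA y01 Sq Sp.
lra.
Qed.

Lemma measurable_cell_width : measurable_fun (`]0, 1[%classic : set R) X.
Proof. by apply: measurable_strip => x y; exact: pc_mono1. Qed.

Lemma measurable_cell_height : measurable_fun (`]0, 1[%classic : set R) Y.
Proof. by apply: measurable_strip => x y; exact: pc_mono2. Qed.

Let measurable_ind : measurable_fun (`]0, 1[%classic : set R)
  (fun t => (k * \1_cell_range t)%:E).
Proof.
apply/measurable_EFinP; apply: measurable_funM => //.
by apply: measurable_indic; exact: measurable_itv.
Qed.

Lemma measurable_cell_bound b : measurable_fun (`]0, 1[%classic : set R) (cell_bound b).
Proof.
have mw := measurable_cell_width; have mh := measurable_cell_height.
case: b; last exact: emeasurable_funD.
by apply: measurable_funeM; do 2 apply: emeasurable_funD => //.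
Qed.

Definition cell_cost (b : bool) : R :=
  let c := (x1 - x0) * (A (x1, y1) - A (x1, y0)) +
           (y1 - y0) * (A (x1, y1) - A (x0, y1)) in
  if b then (Num.sqrt 2)^-1 * (c + k * (A (x1, y1) - A (x0, y0))) else c.

(** By the rectangle inequality the increments of A across the cell are largest on the right and the
    upper edge, which gives the constants for [integral_strip_le]. *)
Lemma integral_cell_bound_le b :
  (\int[lam]_(t in `]0%R, 1%R[) cell_bound b t <= (cell_cost b)%:E)%E.
Proof.
have mw := measurable_cell_width; have mh := measurable_cell_height.
have w0 t : (0 <= X t)%E by case/andP: (cell_width_bound A y0 y1 x01 t).
have h0 t : (0 <= Y t)%E by case/andP: (cell_height_bound A x0 x1 y01 t).
have i0 t : (0 <= (k * \1_cell_range t)%:E)%E.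
  by rewrite lee_fin mulr_ge0 // cell_defect_ge0.
have IX : (\int[lam]_(t in `]0%R, 1%R[) X t <=
    ((x1 - x0) * (A (x1, y1) - A (x1, y0)))%:E)%E.
  apply: integral_strip_le => //; try by move=> x y; exact: pc_mono1.
    by rewrite subr_ge0; exact: pc_mono2.
  by move=> x /andP[_ hx]; have := pc_incr HA hx y01; lra.
have IY : (\int[lam]_(t in `]0%R, 1%R[) Y t <=
    ((y1 - y0) * (A (x1, y1) - A (x0, y1)))%:E)%E.
  apply: integral_strip_le => //; try by move=> x y; exact: pc_mono2.
    by rewrite subr_ge0; exact: pc_mono1.
  by move=> y /andP[_ hy]; have := pc_incr HA x01 hy; lra.
have II : (\int[lam]_(t in `]0%R, 1%R[) (k * \1_cell_range t)%:E <=
    (k * (A (x1, y1) - A (x0, y0)))%:E)%E.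
  under eq_integral do rewrite EFinM.
  rewrite ge0_integralZl_EFin ?cell_defect_ge0 //; last first.
    by apply/measurable_EFinP; apply: measurable_indic; exact: measurable_itv.
  rewrite integral_indic //=; last exact: measurable_itv.
  rewrite EFinM lee_wpmul2l ?lee_fin ?cell_defect_ge0 //.
  apply: (@le_trans _ _ (lam cell_range)); first by apply: le_lebesgue_outer => t [].
  have A01 : A (x0, y0) <= A (x1, y1) by exact: pc_mono.
  rewrite lebesgue_measure_itv /= lte_fin; case: ltP => h; first by rewrite EFinB.
  by rewrite lee_fin subr_ge0.
have IXY : (\int[lam]_(t in `]0%R, 1%R[) (X t + Y t) <=
   ((x1 - x0) * (A (x1, y1) - A (x1, y0)) +
           (y1 - y0) * (A (x1, y1) - A (x0, y1)))%:E)%E.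
  by rewrite ge0_integralD // EFinD leeD.
case: b; rewrite /cell_bound /cell_cost /=; last exact: IXY.
rewrite ge0_integralZl_EFin ?invr_ge0 ?sqrtr_ge0 //; last first.
- by do 2 apply: emeasurable_funD => //.
- by move=> t _; rewrite !adde_ge0.
rewrite EFinM lee_wpmul2l ?lee_fin ?invr_ge0 ?sqrtr_ge0 //.
rewrite ge0_integralD //; last exact: emeasurable_funD.
- by rewrite EFinD leeD.
- by move=> t _; rewrite adde_ge0.
Qed.

End CellBound.

(** * Lower bound on a cell *)

(** The witness is the infimum of the points of [a, b] where f is at least t; the Lipschitz bound
    shows that it is attained. Left of a, monotonicity and f a < t suffice. *)
Lemma lipschitz_first_passage (R : realType) (f : R -> R) (a b t : R) :
  {homo f : x y / x <= y} -> (forall x y, x <= y -> f y - f x <= y - x) ->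
  a <= b -> f a < t -> t <= f b ->
  exists2 y, a <= y <= b & t <= f y /\ forall y', y' < y -> f y' < t.
Proof.
move=> fnd flip ab fa fb.
pose E := [set y | a <= y <= b /\ t <= f y].
have Eb : E b by split=> //; rewrite ab lexx.
have Einf : has_inf E by split; [exists b | exists a => y [/andP[]]].
have ay : a <= inf E by apply: lb_le_inf; [exists b | move=> y [/andP[]]].
have yb : inf E <= b by apply: ge_inf => //; case: Einf.
exists (inf E); first by rewrite ay.
split.
  rewrite leNgt; apply/negP => lt.
  have e0 : 0 < t - f (inf E) by rewrite subr_gt0.
  have [y [/andP[y1' y2] ty] yE] := inf_adherent e0 Einf.
  have Ey : inf E <= y by apply: ge_inf; [case: Einf | split=> //; rewrite y1'].
  by have := flip _ _ Ey; lra.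
move=> y' y'E; rewrite ltNge; apply/negP => ty'.
have [ay'|y'a] := leP a y'.
  have : E y' by split=> //; rewrite ay' /= (le_trans (ltW y'E)).
  by move=> Ey'; have := ge_inf Einf.2 Ey'; lra.
by have := fnd _ _ (ltW y'a); lra.
Qed.

Section ClosedCell.
Variables (R : realType) (A : R * R -> R) (HA : plane_copula A).
Variables (x0 x1 y0 y1 : R).
Hypotheses (x0_gt0 : 0 < x0) (x01 : x0 <= x1) (x1_lt1 : x1 < 1).
Hypotheses (y0_gt0 : 0 < y0) (y01 : y0 <= y1) (y1_lt1 : y1 < 1).
Local Notation lam := (@lebesgue_measure R).
Local Notation X := (cell_width A x0 x1 y0 y1).
Local Notation Y := (cell_height A x0 x1 y0 y1).

Definition closed_trace (t : R) : set (R * R) :=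
  level_boundary A t `&` [set p | x0 <= p.1 <= x1 /\ y0 <= p.2 <= y1].

Lemma closed_trace_chain t U : U `<=` closed_trace t -> decreasing_chain U.
Proof.
by move=> US p q /US[bp _] /US[bq _]; exact: level_boundary_chain bp bq.
Qed.

(** Over each abscissa counted on the left, the first passage of A through t, going up, is a point
    of the level boundary. *)
Lemma cell_width_le_trace t : (X t <= lam (fst @` closed_trace t))%E.
Proof.
apply: le_lebesgue_outer => x [/andP[h1 h2] /andP[h3 h4]].
have [y /andP[y1' y2] [h5 h6]] : exists2 y, y0 <= y <= y1 &
    t <= A (x, y) /\ forall y', y' < y -> A (x, y') < t.
  apply: (@lipschitz_first_passage _ (fun y => A (x, y))) => //.
    by move=> u v; exact: pc_mono2.
  by move=> u v; exact: pc_lip2.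
exists (x, y) => //; split; last by rewrite /= (ltW h1) h2 y1' y2.
apply: level_boundaryP2 => //.
  by rewrite (lt_trans x0_gt0 h1) (le_lt_trans h2 x1_lt1).
by rewrite (lt_le_trans y0_gt0 y1') (le_lt_trans y2 y1_lt1).
Qed.

Lemma cell_height_le_trace t : (Y t <= lam (snd @` closed_trace t))%E.
Proof.
apply: le_lebesgue_outer => y [/andP[h1 h2] /andP[h3 h4]].
have [x /andP[x1' x2] [h5 h6]] : exists2 x, x0 <= x <= x1 &
    t <= A (x, y) /\ forall x', x' < x -> A (x', y) < t.
  apply: (@lipschitz_first_passage _ (fun x => A (x, y))) => //.
    by move=> u v; exact: pc_mono1.
  by move=> u v; exact: pc_lip1.
exists (x, y) => //; split; last by rewrite /= (ltW h1) h2 x1' x2.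
apply: level_boundaryP1 => //.
  by rewrite (lt_le_trans x0_gt0 x1') (le_lt_trans x2 x1_lt1).
by rewrite (lt_trans y0_gt0 h1) (le_lt_trans h2 y1_lt1).
Qed.

(* [None] stands for the antidiagonal direction, [Some true] and [Some false]
   for the horizontal and the vertical ones. *)
Definition directional_measure (d : option bool) (U : set (R * R)) : \bar R :=
  match d with
  | None => chain_width U
  | Some true => lam (fst @` U)
  | Some false => lam (snd @` U)
  end.

Definition directional_bound (d : option bool) (t : R) : \bar R :=
  match d with
  | None => ((Num.sqrt 2)^-1%:E * (X t + Y t))%E
  | Some true => X t
  | Some false => Y t
  end.

Definition directional_cost (d : option bool) : R :=
  let a := (x1 - x0) * (A (x0, y1) - A (x0, y0)) in
  let b := (y1 - y0) * (A (x1, y0) - A (x0, y0)) in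
  match d with
  | None => (Num.sqrt 2)^-1 * (a + b)
  | Some true => a
  | Some false => b
  end.

Lemma directional_bound_le d t :
  (directional_bound d t <= directional_measure d (closed_trace t))%E.
Proof.
case: d => [[]|] /=.
- exact: cell_width_le_trace.
- exact: cell_height_le_trace.
rewrite lee_wpmul2l ?lee_fin ?invr_ge0 ?sqrtr_ge0 //.
by rewrite leeD ?cell_width_le_trace ?cell_height_le_trace.
Qed.

Lemma directional_bound_ge0 d t : (0 <= directional_bound d t)%E.
Proof.
have := cell_width_bound A y0 y1 x01 t => /andP[w0 _].
have := cell_height_bound A x0 x1 y01 t => /andP[h0 _].
case: d => [[]|] //=.
by rewrite mule_ge0 ?lee_fin ?invr_ge0 ?sqrtr_ge0 // adde_ge0.
Qed.

Lemma measurable_directional_bound d :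
  measurable_fun (`]0, 1[%classic : set R) (directional_bound d).
Proof.
have mw := measurable_cell_width HA x0 x1 y0 y1.
have mh := measurable_cell_height HA x0 x1 y0 y1.
by case: d => [[]|] //=; apply: measurable_funeM; exact: emeasurable_funD.
Qed.

(** The rectangle inequality now serves from below: increments across the cell are smallest on the
    left and the lower edge. *)
Lemma directional_cost_le_integral d : ((directional_cost d)%:E <=
  \int[lam]_(t in `]0%R, 1%R[) directional_bound d t)%E.
Proof.
have A0 x y : 0 <= x -> 0 <= y -> 0 <= A (x, y).
  by move=> hx hy; rewrite -(pc_bot1 HA 0); apply: pc_mono.
have A1 x y : x <= 1 -> y <= 1 -> A (x, y) <= 1.
  move=> hx hy; rewrite -[leRHS](pc_top1 HA (y := 1)); last lra.
  by apply: pc_mono.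
have mw := measurable_cell_width HA x0 x1 y0 y1.
have mh := measurable_cell_height HA x0 x1 y0 y1.
have w0 t : (0 <= X t)%E by case/andP: (cell_width_bound A y0 y1 x01 t).
have h0 t : (0 <= Y t)%E by case/andP: (cell_height_bound A x0 x1 y01 t).
have IX : (((x1 - x0) * (A (x0, y1) - A (x0, y0)))%:E <=
    \int[lam]_(t in `]0%R, 1%R[) X t)%E.
  apply: integral_strip_ge => //; try by move=> x y; exact: pc_mono1.
  - move=> x /andP[/ltW hx _]; apply: A0; last exact: ltW.
    exact: le_trans (ltW x0_gt0) hx.
  - move=> x /andP[_ hx]; apply: A1; last exact: ltW.
    exact: le_trans hx (ltW x1_lt1).
  - by move=> x /andP[hx _]; have := pc_incr HA (ltW hx) y01; lra.
have IY : (((y1 - y0) * (A (x1, y0) - A (x0, y0)))%:E <=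
    \int[lam]_(t in `]0%R, 1%R[) Y t)%E.
  apply: integral_strip_ge => //; try by move=> x y; exact: pc_mono2.
  - move=> y /andP[/ltW hy _]; apply: A0; first exact: ltW.
    exact: le_trans (ltW y0_gt0) hy.
  - move=> y /andP[_ hy]; apply: A1; first exact: ltW.
    exact: le_trans hy (ltW y1_lt1).
  - by move=> y /andP[hy _]; have := pc_incr HA x01 (ltW hy); lra.
case: d => [[]|] //=.
rewrite ge0_integralZl_EFin ?invr_ge0 ?sqrtr_ge0 //; last first.
- exact: emeasurable_funD.
- by move=> t _; rewrite adde_ge0.
rewrite EFinM lee_wpmul2l ?lee_fin ?invr_ge0 ?sqrtr_ge0 //.
by rewrite ge0_integralD // EFinD leeD.
Qed.

End ClosedCell.

(** * Grids *)

Section Grid.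
Variables (R : realType) (n : nat).
Local Notation lam := (@lebesgue_measure R).

Definition gridpt (i : nat) : R := i%:R / n.+1%:R.

Lemma gridptS i : gridpt i.+1 = gridpt i + n.+1%:R^-1.
Proof. by rewrite /gridpt -natr1 mulrDl mul1r. Qed.

Lemma gridpt_le i j : (i <= j)%N -> gridpt i <= gridpt j.
Proof. by move=> ij; rewrite /gridpt ler_wpM2r ?invr_ge0 // ler_nat. Qed.

Lemma gridpt_ge0 i : 0 <= gridpt i.
Proof. by rewrite divr_ge0. Qed.

Lemma gridpt0 : gridpt 0 = 0.
Proof. by rewrite /gridpt mul0r. Qed.

Lemma gridpt1 : gridpt n.+1 = 1.
Proof. by rewrite /gridpt divff // pnatr_eq0. Qed.

Lemma gridpt_cover (x : R) : 0 < x <= 1 ->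
  exists i : 'I_n.+1, gridpt i < x <= gridpt i.+1.
Proof.
move=> /andP[x0 x1].
have ex : exists k, x <= gridpt k by exists n.+1; rewrite gridpt1.
case: (ex_minnP ex) => k xk kmin.
case: k xk kmin => [|k] xk kmin; first by move: xk; rewrite gridpt0; lra.
have kn : (k < n.+1)%N by apply: kmin; rewrite gridpt1.
exists (Ordinal kn) => /=; rewrite xk andbT ltNge; apply/negP => /kmin.
by rewrite ltnn.
Qed.

Variables (A : R * R -> R) (HA : plane_copula A).

Lemma length_measure_le_cost (G : 'I_n.+1 * 'I_n.+1 -> bool) :
  (length_measure A <= (\sum_(Q : 'I_n.+1 * 'I_n.+1)
    cell_cost A (gridpt Q.1) (gridpt Q.1.+1) (gridpt Q.2) (gridpt Q.2.+1)
      (G Q))%:E)%E.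
Proof.
have gS (i : 'I_n.+1) : gridpt i <= gridpt i.+1 by exact: gridpt_le.
pose bd (Q : 'I_n.+1 * 'I_n.+1) := cell_bound A (gridpt Q.1) (gridpt Q.1.+1)
    (gridpt Q.2) (gridpt Q.2.+1) (G Q).
have bd0 Q t : (0 <= bd Q t)%E.
  have [r r0 E] := cell_bound_fin HA (gS Q.1) (gS Q.2) (G Q) t.
  by rewrite /bd E lee_fin.
apply: (@le_trans _ _ (\int[lam]_(t in `]0%R, 1%R[) \sum_Q bd Q t)%E).
  apply: le_ge0_integral => t; rewrite /= in_itv /= => t01; apply/andP; split.
    apply: le_trans (_ : hausdorff1_pre 1 (level_boundary A t) <= _)%E.
      apply: le_ereal_inf_tmp => _ [U _ <-]; apply: nneseries_ge0 => i _ _.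
      exact: ediam_ge0.
    by apply: ereal_sup_ubound; exists 1 => /=.
  have [Psi hPsi] := choice (fun Q : 'I_n.+1 * 'I_n.+1 =>
    cell_bound_osc HA (gS Q.1) (gS Q.2) (G Q) t).
  have fE Q : bd Q t = (fine (bd Q t))%:E.
    by have [r _ E] := cell_bound_fin HA (gS Q.1) (gS Q.2) (G Q) t; rewrite /bd E.
  rewrite (eq_bigr (fun Q => (fine (bd Q t))%:E)); last by move=> Q _; exact: fE.
  rewrite sumEFin /level_length.
  apply: (@hausdorff1_le_sum _ _ (fun Q : 'I_n.+1 * 'I_n.+1 =>
    cell_trace A (gridpt Q.1) (gridpt Q.1.+1) (gridpt Q.2) (gridpt Q.2.+1) t)
    Psi (fun Q => fine (bd Q t))).
  - move=> p bp; have [/andP[p1 p2] /andP[p3 p4]] := level_boundary_square bp.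
    have [|i hi] := @gridpt_cover p.1; first by rewrite p1 ltW.
    have [|j hj] := @gridpt_cover p.2; first by rewrite p3 ltW.
    by exists (i, j).
  - by move=> Q; exact: fine_ge0.
  - by move=> Q p q Sp Sq; case: (hPsi Q p q Sp Sq).
  - by move=> Q p q Sp Sq; rewrite -lee_fin -fE; case: (hPsi Q p q Sp Sq).
rewrite ge0_integral_sum //; last first.
  by move=> Q; exact: measurable_cell_bound.
rewrite -sumEFin; apply: lee_sum => Q _; exact: integral_cell_bound_le.
Qed.

(** Cells shrunk by eta on every side are at least 2 eta apart in some coordinate, so at scale eta
    no covering set meets two of them and the directional bounds add up. *)
Lemma cost_le_length_measure (eta : R) (d : 'I_n.+1 * 'I_n.+1 -> option bool) :
  0 < eta -> eta + eta <= n.+1%:R^-1 ->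
  ((\sum_(Q : 'I_n.+1 * 'I_n.+1) directional_cost A
    (gridpt Q.1 + eta) (gridpt Q.1.+1 - eta) (gridpt Q.2 + eta) (gridpt Q.2.+1 - eta) (d Q))%:E <= length_measure A)%E.
Proof.
move=> eta0 eta1.
have g0 (i : 'I_n.+1) : 0 < gridpt i + eta by rewrite ltr_wpDl // gridpt_ge0.
have g1 (i : 'I_n.+1) : gridpt i.+1 - eta < 1.
  have : gridpt i.+1 <= gridpt n.+1 by exact: gridpt_le.
  by rewrite gridpt1; lra.
have gS (i : 'I_n.+1) : gridpt i + eta <= gridpt i.+1 - eta.
  by rewrite gridptS; move: eta1; set u := _^-1; lra.
pose lo (Q : 'I_n.+1 * 'I_n.+1) := directional_bound A (gridpt Q.1 + eta)
  (gridpt Q.1.+1 - eta) (gridpt Q.2 + eta) (gridpt Q.2.+1 - eta) (d Q).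
have lo0 Q t : (0 <= lo Q t)%E by exact: directional_bound_ge0.
apply: (@le_trans _ _ (\int[lam]_(t in `]0%R, 1%R[) \sum_Q lo Q t)%E).
  rewrite ge0_integral_sum //; last first.
    by move=> Q; exact: measurable_directional_bound.
  rewrite -sumEFin; apply: lee_sum => Q _; exact: directional_cost_le_integral.
apply: le_ge0_integral => t; rewrite /= in_itv /= => t01; apply/andP; split.
  exact: sume_ge0.
apply: le_trans (_ : hausdorff1_pre eta (level_boundary A t) <= _)%E; last first.
  by apply: ereal_sup_ubound; exists eta.
pose S (Q : 'I_n.+1 * 'I_n.+1) := closed_trace A (gridpt Q.1 + eta)
  (gridpt Q.1.+1 - eta) (gridpt Q.2 + eta) (gridpt Q.2.+1 - eta) t.
apply: (@le_trans _ _ (\sum_Q directional_measure (d Q) (S Q))%E).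
  by apply: lee_sum => Q _; exact: directional_bound_le.
apply: (@hausdorff1_pre_ge_sum _ _ S (fun Q => @directional_measure R (d Q))).
- by move=> Q p [].
- have sep (i j : 'I_n.+1) (x y : R) : (i < j)%N -> x <= gridpt i.+1 - eta ->
      gridpt j + eta <= y -> eta < y - x.
    by move=> ij hx hy; have := gridpt_le ij; lra.
  move=> [i j] [i' j'] p q [_ [/andP[a1 a2] /andP[a3 a4]]].
  move=> [_ [/andP[b1 b2] /andP[b3 b4]]] /= pq.
  have pq1 := le_trans (le_edist1 p q) pq.
  have pq2 := le_trans (le_edist2 p q) pq.
  have qp : edist q p <= eta.
    by move: pq; rewrite /edist -(sqrrN (p.1 - q.1)) -(sqrrN (p.2 - q.2)) !opprB.
  have qp1 := le_trans (le_edist1 q p) qp.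
  have qp2 := le_trans (le_edist2 q p) qp.
  congr (_, _); apply: ord_inj.
    case: (ltngtP (nat_of_ord i) i') => // h.
    + by have /lt_le_trans /(_ qp1) := sep _ _ _ _ h a2 b1; rewrite ltxx.
    + by have /lt_le_trans /(_ pq1) := sep _ _ _ _ h b2 a1; rewrite ltxx.
  case: (ltngtP (nat_of_ord j) j') => // h.
  + by have /lt_le_trans /(_ qp2) := sep _ _ _ _ h a4 b3; rewrite ltxx.
  + by have /lt_le_trans /(_ pq2) := sep _ _ _ _ h b4 a3; rewrite ltxx.
- move=> Q; case: (d Q) => [[]|] /=; rewrite /chain_width ?image_set0 ?measure0 //.
  by rewrite adde0 mule0.
- move=> Q U; case: (d Q) => [[]|] /=; try exact: lebesgue_outer_ge0.
  exact: chain_width_ge0.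
- move=> Q U US; case: (d Q) => [[]|] /=.
  + exact: lebesgue_fst_le_ediam.
  + exact: lebesgue_snd_le_ediam.
  + by apply: chain_width_le_ediam; exact: closed_trace_chain US.
- move=> Q U ->; case: (d Q) => [[]|] /=; try exact: lebesgue_image_bigcup.
  exact: chain_width_bigcup.
Qed.

End Grid.

(** * Costs summed over the grid *)

Section GridSum.
Variables (R : realType) (n : nat).
Local Notation gridpt := (gridpt R n).
Local Notation delta := (n.+1%:R^-1 : R).
Variables (A : R * R -> R) (HA : plane_copula A).

Let delta_gt0 : 0 < delta.
Proof. by rewrite invr_gt0 ltr0n. Qed.

Lemma sum_gridptS : \sum_(i < n.+1) delta * gridpt i.+1 = (1 + delta) / 2.
Proof.
have gauss k : \sum_(i < k) (i.+1%:R : R) = k%:R * (k%:R + 1) / 2.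
  elim: k => [|k IH]; first by rewrite big_ord0 !mul0r.
  by rewrite big_ord_recr /= IH -!natr1; field.
have m0 : n.+1%:R != 0 :> R by rewrite pnatr_eq0.
rewrite -mulr_sumr /gridpt -mulr_suml gauss.
by field.
Qed.

Lemma sum_gridpt : \sum_(i < n.+1) delta * gridpt i = (1 - delta) / 2.
Proof.
have -> : \sum_(i < n.+1) delta * gridpt i =
    \sum_(i < n.+1) delta * gridpt i.+1 - \sum_(i < n.+1) delta * delta.
  by rewrite -sumrB; apply: eq_bigr => i _; rewrite gridptS; ring.
rewrite sum_gridptS sumr_const card_ord -[X in _ - X]mulr_natl mulrA divff ?pnatr_eq0 //.
by rewrite mul1r; move: delta => d; field.
Qed.

Let top1 (i : nat) : (i <= n.+1)%N -> A (1, gridpt i) = gridpt i.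
Proof.
by move=> h; apply: pc_top1 => //; rewrite gridpt_ge0 -(gridpt1 R n) gridpt_le.
Qed.

Let top2 (i : nat) : (i <= n.+1)%N -> A (gridpt i, 1) = gridpt i.
Proof.
by move=> h; apply: pc_top2 => //; rewrite gridpt_ge0 -(gridpt1 R n) gridpt_le.
Qed.

Lemma telescope_col (x : R) :
  \sum_(j < n.+1) (A (x, gridpt j.+1) - A (x, gridpt j)) = A (x, 1).
Proof.
rewrite -(big_mkord xpredT (fun j => A (x, gridpt j.+1) - A (x, gridpt j))).
rewrite (telescope_sumr (fun j => A (x, gridpt j))) //.
by rewrite gridpt1 gridpt0 (pc_bot2 HA) subr0.
Qed.

Lemma telescope_row (y : R) :
  \sum_(i < n.+1) (A (gridpt i.+1, y) - A (gridpt i, y)) = A (1, y).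
Proof.
rewrite -(big_mkord xpredT (fun i => A (gridpt i.+1, y) - A (gridpt i, y))).
rewrite (telescope_sumr (fun i => A (gridpt i, y))) //.
by rewrite gridpt1 gridpt0 (pc_bot1 HA) subr0.
Qed.

Local Notation cell := ('I_n.+1 * 'I_n.+1)%type.

Definition outer_cost (Q : cell) : R :=
  delta * (A (gridpt Q.1.+1, gridpt Q.2.+1) - A (gridpt Q.1.+1, gridpt Q.2)) +
  delta * (A (gridpt Q.1.+1, gridpt Q.2.+1) - A (gridpt Q.1, gridpt Q.2.+1)).

Definition inner_cost (Q : cell) : R :=
  delta * (A (gridpt Q.1, gridpt Q.2.+1) - A (gridpt Q.1, gridpt Q.2)) +
  delta * (A (gridpt Q.1.+1, gridpt Q.2) - A (gridpt Q.1, gridpt Q.2)).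

(** The increments telescope along columns and rows; the uniform margins leave two upper Riemann
    sums of the identity. [inner_cost] gives the lower ones, so the two totals differ by 2 delta. *)
Lemma sum_outer_cost : \sum_Q outer_cost Q = 1 + delta.
Proof.
rewrite big_split /=.
rewrite -(pair_bigA _ (fun i j : 'I_n.+1 =>
  delta * (A (gridpt i.+1, gridpt j.+1) - A (gridpt i.+1, gridpt j)))) /=.
rewrite -(pair_bigA _ (fun i j : 'I_n.+1 =>
  delta * (A (gridpt i.+1, gridpt j.+1) - A (gridpt i, gridpt j.+1)))) /=.
rewrite [X in _ + X]exchange_big /=.
under eq_bigr do rewrite -mulr_sumr telescope_col top2 //.
under [X in _ + X]eq_bigr do rewrite -mulr_sumr telescope_row top1 //.
by rewrite sum_gridptS; move: delta => d; field.
Qed.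

Lemma sum_inner_cost : \sum_Q inner_cost Q = 1 - delta.
Proof.
rewrite big_split /=.
rewrite -(pair_bigA _ (fun i j : 'I_n.+1 =>
  delta * (A (gridpt i, gridpt j.+1) - A (gridpt i, gridpt j)))) /=.
rewrite -(pair_bigA _ (fun i j : 'I_n.+1 =>
  delta * (A (gridpt i.+1, gridpt j) - A (gridpt i, gridpt j)))) /=.
rewrite [X in _ + X]exchange_big /=.
under eq_bigr do rewrite -mulr_sumr telescope_col top2 1?ltnW //.
under [X in _ + X]eq_bigr do rewrite -mulr_sumr telescope_row top1 1?ltnW //.
by rewrite sum_gridpt; move: delta => d; field.
Qed.

Definition grid_defect (Q : cell) : R :=
  cell_defect A (gridpt Q.1) (gridpt Q.1.+1) (gridpt Q.2) (gridpt Q.2.+1).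

(** Vanishes when A varies in only one variable across the cell; it controls how much X + Y can
    exceed the larger of X and Y. *)
Definition grid_slack (Q : cell) : R :=
  Num.min (A (gridpt Q.1.+1, gridpt Q.2.+1) - A (gridpt Q.1.+1, gridpt Q.2))
          (A (gridpt Q.1.+1, gridpt Q.2.+1) - A (gridpt Q.1, gridpt Q.2.+1)).

Definition grid_error (G : cell -> bool) : R :=
  delta * \sum_Q (if G Q then grid_defect Q else grid_slack Q).

(* The length of a copula with gradient (1, 1) on the cells in G and with at
   most one nonzero partial derivative on the others. *)
Definition grid_length (G : cell -> bool) : R :=
  1 - (2 - Num.sqrt 2) * \sum_(Q | G Q) delta ^+ 2.

Let sqrt2inv : (Num.sqrt 2)^-1 = Num.sqrt 2 / 2 :> R.
Proof.
have s0 := sqrt2_gt0 R; rewrite -[X in _ / X](sqr_sqrt2 R).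
by field; rewrite gt_eqF.
Qed.

Let sqrt2_bounds : 1 <= (Num.sqrt 2 : R) <= 2.
Proof. by have := sqr_sqrt2 R; have := sqrt2_gt0 R; nra. Qed.

(** On G write k for the defect and c for the outer cost. As c >= delta (2 delta - k), dividing c by
    sqrt 2 saves (2 - sqrt 2) delta^2 up to (1 - 1 / sqrt 2) delta k. The defect term adds at most
    sqrt 2 delta k, since A varies by at most 2 delta on the cell. The sum of both errors stays
    below 2 delta k. *)
Lemma cell_cost_le (G : cell -> bool) (Q : cell) :
  cell_cost A (gridpt Q.1) (gridpt Q.1.+1) (gridpt Q.2) (gridpt Q.2.+1) (G Q) <=
  outer_cost Q - (if G Q then (2 - Num.sqrt 2) * delta ^+ 2 else 0)
  + 2 * (delta * if G Q then grid_defect Q else grid_slack Q).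
Proof.
have gx : gridpt Q.1 <= gridpt Q.1.+1 by exact: gridpt_le.
have gy : gridpt Q.2 <= gridpt Q.2.+1 by exact: gridpt_le.
have dx : gridpt Q.1.+1 - gridpt Q.1 = delta by rewrite gridptS addrAC subrr add0r.
have dy : gridpt Q.2.+1 - gridpt Q.2 = delta by rewrite gridptS addrAC subrr add0r.
have k0 := cell_defect_ge0 HA gx gy.
have i1 := pc_incr HA gx gy.
have := pc_mono1 HA (gridpt Q.2.+1) gx; have := pc_mono2 HA (gridpt Q.1.+1) gy.
have := pc_lip HA gx gy.
rewrite /cell_cost /outer_cost /grid_slack /grid_defect /= dx dy sqrt2inv.
move: k0 i1; rewrite /cell_defect dx dy.
set a11 := A (gridpt Q.1.+1, gridpt Q.2.+1); set a10 := A (gridpt Q.1.+1, gridpt Q.2).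
set a01 := A (gridpt Q.1, gridpt Q.2.+1); set a00 := A (gridpt Q.1, gridpt Q.2).
move: delta_gt0 sqrt2_bounds; set d := delta; set s := Num.sqrt 2 => d0 /andP[s1 s2].
move=> k0 i1 tau m1 m2.
case: (G Q) => /=.
  set k := (X in 0 <= X) in k0; set t := a11 - a00.
  have kt : k * t <= k * (2 * d) by apply: ler_wpM2l => //; rewrite /t; lra.
  set c := d * (a11 - a10) + d * (a11 - a01).
  have hc : d * (2 * d - k) <= c.
    rewrite /c -mulrDr; apply: ler_wpM2l; first exact: ltW.
    by rewrite /k; lra.
  have p1 : 0 <= (1 - s / 2) * (c - d * (2 * d - k)) by apply: mulr_ge0; lra.
  have p2 : 0 <= s / 2 * (k * (2 * d) - k * t) by apply: mulr_ge0; lra.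
  have p3 : 0 <= (1 - s / 2) * (d * k).
    by apply: mulr_ge0; [lra | apply: mulr_ge0 => //; exact: ltW].
  by rewrite -[d - (a10 - a00) + (d - (a01 - a00))]/k; lra.
have : 0 <= Num.min (a11 - a10) (a11 - a01) by rewrite le_min !subr_ge0 m1 m2.
by move/(mulr_ge0 (ltW d0)); lra.
Qed.

End GridSum.

(** Shrinking costs 2 eta in the width and 2 eta in the increment of A, and both are at most d. *)
Lemma shrunk_width_ge (R : realType) (A : R * R -> R) (x0 x1 y0 y1 d eta : R) :
  plane_copula A -> 0 <= eta -> eta + eta <= d -> x1 - x0 = d -> y1 - y0 = d ->
  d * (A (x0, y1) - A (x0, y0)) - 4 * (eta * d) <=
  ((x1 - eta) - (x0 + eta)) * (A (x0 + eta, y1 - eta) - A (x0 + eta, y0 + eta)).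
Proof.
move=> HA e0 e1 dx dy.
have xe : x0 <= x0 + eta by lra.
have y01 : y0 <= y1 by lra.
have i1 := pc_incr HA xe y01.
have ye : y1 - eta <= y1 by lra.
have ye' : y0 <= y0 + eta by lra.
have l1 := pc_lip2 HA (x0 + eta) ye; have l2 := pc_lip2 HA (x0 + eta) ye'.
have l3 := pc_lip2 HA x0 y01.
rewrite (_ : x1 - eta - (x0 + eta) = d - 2 * eta); last lra.
rewrite dy in l3; move: l1 l2 l3 i1.
set a := A (x0, y1) - A (x0, y0) => l1 l2 l3 i1.
have ba : a - 2 * eta <= A (x0 + eta, y1 - eta) - A (x0 + eta, y0 + eta).
  by rewrite /a; lra.
have d2 : 0 <= d - 2 * eta by lra.
have p1 := ler_wpM2l d2 ba.
have p2 : 0 <= eta * (d - a) by rewrite mulr_ge0 // subr_ge0.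
have p3 : 0 <= eta * eta by rewrite mulr_ge0.
lra.
Qed.

Lemma shrunk_height_ge (R : realType) (A : R * R -> R) (x0 x1 y0 y1 d eta : R) :
  plane_copula A -> 0 <= eta -> eta + eta <= d -> x1 - x0 = d -> y1 - y0 = d ->
  d * (A (x1, y0) - A (x0, y0)) - 4 * (eta * d) <=
  ((y1 - eta) - (y0 + eta)) * (A (x1 - eta, y0 + eta) - A (x0 + eta, y0 + eta)).
Proof.
move=> HA e0 e1 dx dy.
have HT : plane_copula (fun p => A (p.2, p.1)).
  case: HA => b1 b2 t1 t2 i m1 m2 l1 l2; split=> //=.
  - by move=> u1 u2 v1 v2 hu hv; rewrite [leLHS]addrC; exact: i.
  - by move=> u1 u2 v hu; exact: m2.
  - by move=> u v1 v2 hv; exact: m1.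
  - by move=> u1 u2 v hu; exact: l2.
  - by move=> u v1 v2 hv; exact: l1.
exact: (@shrunk_width_ge _ _ y0 y1 x0 x1 d eta HT).
Qed.

(** * Two-sided grid estimates of the length measure *)

Section GridEstimate.
Variables (R : realType) (n : nat).
Local Notation gridpt := (gridpt R n).
Local Notation delta := (n.+1%:R^-1 : R).
Variables (A : R * R -> R) (HA : plane_copula A).
Local Notation cell := ('I_n.+1 * 'I_n.+1)%type.

Let delta_gt0 : 0 < delta.
Proof. by rewrite invr_gt0 ltr0n. Qed.

Let delta_le1 : delta <= 1.
Proof. by rewrite invf_le1 ?ltr0n // ler1n. Qed.

Let card_cell : \sum_(Q : cell) delta ^+ 2 = 1.
Proof.
rewrite sumr_const card_prod card_ord -[LHS]mulr_natl natrM expr2.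
by rewrite mulrACA divff ?mulr1 // pnatr_eq0.
Qed.

Lemma length_measure_le_grid (G : cell -> bool) :
  (length_measure A <= (grid_length R G + 2 * grid_error A G + delta)%:E)%E.
Proof.
apply: le_trans (length_measure_le_cost HA G) _; rewrite lee_fin.
apply: le_trans (ler_sum _ (fun Q _ => cell_cost_le HA G Q)) _.
rewrite big_split sumrB /= sum_outer_cost // -big_mkcond /=.
have key (a b c d : R) : a + d - b + c <= a - b + c + d by lra.
by rewrite /grid_length /grid_error -!mulr_sumr; exact: key.
Qed.

Lemma length_measure_le_1delta : (length_measure A <= (1 + delta)%:E)%E.
Proof.
apply: le_trans (length_measure_le_cost HA (fun=> false)) _; rewrite lee_fin.
rewrite -(sum_outer_cost n HA); apply: ler_sum => Q _.
rewrite /cell_cost /outer_cost.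
have dx i : gridpt i.+1 - gridpt i = delta by rewrite gridptS addrAC subrr add0r.
by rewrite !dx.
Qed.

(** Chosen so that shrinking costs delta^3 / 2 per direction and cell, hence delta in all over both
    directions and the delta^-2 cells. *)
Let eta : R := delta ^+ 2 / 8.

Let eta_gt0 : 0 < eta.
Proof. by rewrite divr_gt0 // exprn_gt0. Qed.

Let eta_small : eta + eta <= delta.
Proof.
move: delta_gt0 delta_le1; rewrite /eta; move: delta => d d0 d1.
have : 0 <= d * (1 - d) by rewrite mulr_ge0 ?subr_ge0 // ltW.
lra.
Qed.

Let eta_delta : 4 * (eta * delta) = delta * delta ^+ 2 / 2.
Proof. by rewrite /eta; move: delta => d; field. Qed.

Let inner_split (Q : cell) :
  inner_cost A Q - delta * delta ^+ 2 <=
  ((gridpt Q.1.+1 - eta) - (gridpt Q.1 + eta)) *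
    (A (gridpt Q.1 + eta, gridpt Q.2.+1 - eta) - A (gridpt Q.1 + eta, gridpt Q.2 + eta)) +
  ((gridpt Q.2.+1 - eta) - (gridpt Q.2 + eta)) *
    (A (gridpt Q.1.+1 - eta, gridpt Q.2 + eta) - A (gridpt Q.1 + eta, gridpt Q.2 + eta)).
Proof.
have dx : gridpt Q.1.+1 - gridpt Q.1 = delta by rewrite gridptS addrAC subrr add0r.
have dy : gridpt Q.2.+1 - gridpt Q.2 = delta by rewrite gridptS addrAC subrr add0r.
have w := shrunk_width_ge HA (ltW eta_gt0) eta_small dx dy.
have h := shrunk_height_ge HA (ltW eta_gt0) eta_small dx dy.
rewrite eta_delta in w h; apply: le_trans (lerD w h).
by rewrite /inner_cost; move: (delta * delta ^+ 2) delta => c d; lra.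
Qed.

Lemma length_measure_ge_sqrt2 :
  (((Num.sqrt 2)^-1 * (1 - 2 * delta))%:E <= length_measure A)%E.
Proof.
apply: le_trans (cost_le_length_measure HA (fun=> None) eta_gt0 eta_small).
rewrite lee_fin.
have s0 : 0 <= (Num.sqrt 2)^-1 :> R by rewrite invr_ge0 sqrtr_ge0.
have d3 : \sum_(Q : cell) delta * delta ^+ 2 = delta.
  by rewrite -mulr_sumr card_cell mulr1.
apply: le_trans (_ : (Num.sqrt 2)^-1 *
  \sum_(Q : cell) (inner_cost A Q - delta * delta ^+ 2) <= _).
  apply: ler_wpM2l => //; rewrite sumrB sum_inner_cost // d3.
  by move: delta => d; lra.
rewrite mulr_sumr; by apply: ler_sum => Q _; apply: ler_wpM2l.
Qed.

(** Outside G the direction with the larger inner increment is kept; the smaller one is lost, and it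
    is at most the slack. *)
Let slack_direction (G : cell -> bool) (Q : cell) : option bool :=
  if G Q then None else
  Some (A (gridpt Q.1.+1, gridpt Q.2) - A (gridpt Q.1, gridpt Q.2) <=
        A (gridpt Q.1, gridpt Q.2.+1) - A (gridpt Q.1, gridpt Q.2)).

(** On G the inner cost is at most 2 delta^2 by the Lipschitz bounds, so dividing it by sqrt 2 loses
    at most (2 - sqrt 2) delta^2. *)
Let directional_cost_ge (G : cell -> bool) (Q : cell) :
  inner_cost A Q - delta * delta ^+ 2
    - (if G Q then (2 - Num.sqrt 2) * delta ^+ 2 else 0)
    - delta * (if G Q then grid_defect A Q else grid_slack A Q) <=
  directional_cost A (gridpt Q.1 + eta) (gridpt Q.1.+1 - eta)
    (gridpt Q.2 + eta) (gridpt Q.2.+1 - eta) (slack_direction G Q).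
Proof.
have gx : gridpt Q.1 <= gridpt Q.1.+1 by exact: gridpt_le.
have gy : gridpt Q.2 <= gridpt Q.2.+1 by exact: gridpt_le.
have dx : gridpt Q.1.+1 - gridpt Q.1 = delta by rewrite gridptS addrAC subrr add0r.
have dy : gridpt Q.2.+1 - gridpt Q.2 = delta by rewrite gridptS addrAC subrr add0r.
have w := shrunk_width_ge HA (ltW eta_gt0) eta_small dx dy.
have h := shrunk_height_ge HA (ltW eta_gt0) eta_small dx dy.
rewrite eta_delta in w h.
have d3 : 0 <= delta * delta ^+ 2 by rewrite mulr_ge0 ?exprn_ge0 // ltW.
have k0 := cell_defect_ge0 HA gx gy.
have i1 := pc_incr HA gx gy.
have isp := inner_split Q.
have l1 := pc_lip1 HA (gridpt Q.2) gx; have l2 := pc_lip2 HA (gridpt Q.1) gy.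
rewrite dx in l1; rewrite dy in l2.
rewrite /slack_direction; case: (G Q).
  rewrite /directional_cost /=.
  have s0 : 0 <= (Num.sqrt 2)^-1 :> R by rewrite invr_ge0 sqrtr_ge0.
  apply: le_trans (ler_wpM2l s0 isp).
  have sE : (Num.sqrt 2)^-1 = Num.sqrt 2 / 2 :> R.
    have s1 := sqrt2_gt0 R; rewrite -[X in _ / X](sqr_sqrt2 R).
    by field; rewrite gt_eqF.
  have : (Num.sqrt 2 : R) <= 2 by have := sqr_sqrt2 R; have := sqrt2_gt0 R; nra.
  rewrite sE; set s := Num.sqrt 2 => s2.
  have ic : inner_cost A Q <= 2 * delta ^+ 2.
    rewrite /inner_cost.
    have := ler_wpM2l (ltW delta_gt0) l1; have := ler_wpM2l (ltW delta_gt0) l2.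
    by rewrite expr2; move: delta => d; lra.
  have p1 : 0 <= (1 - s / 2) * (2 * delta ^+ 2 - inner_cost A Q).
    by apply: mulr_ge0; [lra | rewrite subr_ge0].
  have p2 : 0 <= (1 - s / 2) * (delta * delta ^+ 2).
    by apply: mulr_ge0; [lra |].
  have p3 : 0 <= delta * grid_defect A Q by rewrite mulr_ge0 // ltW.
  move: p1 p2 p3 => /=; move: (inner_cost A Q) (grid_defect A Q) delta => u v d.
  lra.
have sl1 : delta * Num.min
   (A (gridpt Q.1, gridpt Q.2.+1) - A (gridpt Q.1, gridpt Q.2))
   (A (gridpt Q.1.+1, gridpt Q.2) - A (gridpt Q.1, gridpt Q.2)) <= delta * grid_slack A Q.
  rewrite ler_pM2l // /grid_slack le_min !ge_min.
  apply/andP; split; apply/orP; [left|right]; lra.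
rewrite /inner_cost subr0 /directional_cost.
case: ifPn => hd.
  rewrite (min_idPr hd) in sl1; move: sl1 w d3 => /=.
  by move: (grid_slack A Q) (delta * delta ^+ 2) delta => u c d; lra.
rewrite -ltNge in hd; rewrite (min_idPl (ltW hd)) in sl1; move: sl1 h d3 => /=.
by move: (grid_slack A Q) (delta * delta ^+ 2) delta => u c d; lra.
Qed.

Lemma length_measure_ge_grid (G : cell -> bool) :
  ((grid_length R G - 2 * grid_error A G - 2 * delta)%:E <= length_measure A)%E.
Proof.
apply: le_trans (cost_le_length_measure HA (slack_direction G) eta_gt0 eta_small).
rewrite lee_fin.
apply: le_trans (ler_sum _ (fun Q _ => directional_cost_ge G Q)).
(* Nonnegativity lets one error be weakened to two, to match the upper estimate. *)
have err0 : 0 <= grid_error A G.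
  apply: mulr_ge0; [exact: ltW | apply: sumr_ge0 => Q _].
  have gx : gridpt Q.1 <= gridpt Q.1.+1 by exact: gridpt_le.
  have gy : gridpt Q.2 <= gridpt Q.2.+1 by exact: gridpt_le.
  case: (G Q); first exact: cell_defect_ge0.
  by rewrite /grid_slack le_min !subr_ge0 pc_mono1 ?pc_mono2.
have d3 : \sum_(Q : cell) delta * delta ^+ 2 = delta.
  by rewrite -mulr_sumr card_cell mulr1.
rewrite !sumrB sum_inner_cost // d3 -big_mkcond /=.
have key (x y d : R) : 0 <= y -> 1 - x - 2 * y - 2 * d <= 1 - d - d - x - y.
  by lra.
by move: err0; rewrite /grid_length /grid_error -!mulr_sumr; exact: key.
Qed.

End GridEstimate.

(** * Slices and moduli of continuity *)

(** On K, g is a uniformly continuous function of f. Otherwise pairs with f-values ever closer and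
    g-values omega apart would cluster in K x K at a pair where f agrees and g does not. Applied to
    (id, h) and to (h, id). *)
Lemma compact_modulus (R : realType) (K : set R) (f g : R -> R) (omega : R) :
  compact K -> {within K, continuous f} -> {within K, continuous g} ->
  (forall s t, K s -> K t -> f s = f t -> g s = g t) -> 0 < omega ->
  exists2 delta : R, 0 < delta &
    forall s t, K s -> K t -> `|f s - f t| < delta -> `|g s - g t| < omega.
Proof.
move=> cK cf cg fg omega0; apply: contrapT => no.
have bad n : exists p : R * R, [/\ K p.1, K p.2,
    `|f p.1 - f p.2| < n.+1%:R^-1 & omega <= `|g p.1 - g p.2| ].
  apply: contrapT => nb; apply: no; exists n.+1%:R^-1; first by rewrite invr_gt0.
  move=> s t Ks Kt fst; rewrite ltNge; apply/negP => le.
  by apply: nb; exists (s, t).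
have [u hu] := choice bad.
have cKK : compact (K `*` K) by exact: compact_setX.
have uK : \forall n \near \oo, (K `*` K) (u n).
  by apply: nearW => n; case: (hu n).
have [[a b] [[/= Ka Kb] cl]] := cKK (u @ \oo) _ uK.
have near_pt (k : R -> R) (x e : R) : {within K, continuous k} -> K x -> 0 < e ->
    \forall y \near x, K y -> `|k x - k y| < e.
  move=> /subspace_continuousP ck Kx e0.
  by have /cvgrPdist_lt /(_ e e0) := ck x Kx; rewrite near_withinE.
have approx (e : R) : 0 < e -> `|f a - f b| < e + e + e /\
    omega < `|g a - g b| + e + e.
  move=> e0.
  pose V (x : R) := [set y : R | (K y -> `|f x - f y| < e) /\ (K y -> `|g x - g y| < e)].
  have nV x : K x -> nbhs x (V x).
    by move=> Kx; apply: filterI; [exact: near_pt cf Kx e0 | exact: near_pt cg Kx e0].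
  pose W := [set q : R * R | [/\ K q.1, K q.2, `|f q.1 - f q.2| < e &
    omega <= `|g q.1 - g q.2| ]].
  have uW : \forall n \near \oo, W (u n).
    near=> n; have [h1 h2 h3 h4] := hu n; split => //.
    by apply: lt_trans h3 _; near: n; exact: near_infty_natSinv_lt (PosNum e0).
  have nVV : nbhs (a, b) (V a `*` V b).
    by exists (V a, V b); [split; exact: nV | move=> [? ?]].
  have [[s t] [[/= Ks Kt fst gst] [/= [fas gas] [fbt gbt]]]] := cl _ _ uW nVV.
  have {}fas := fas Ks; have {}gas := gas Ks.
  have {}fbt := fbt Kt; have {}gbt := gbt Kt.
  have tri (x y z w : R) : `|x - y| <= `|x - z| + `|z - w| + `|y - w| :> R.
    rewrite (_ : x - y = (x - z) + (z - w) - (y - w)); last by ring.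
    apply: le_trans (ler_normB _ _) _; rewrite lerD2r; exact: ler_normD.
  split; first by have := tri (f a) (f b) (f s) (f t); lra.
  have := tri (g s) (g t) (g a) (g b).
  rewrite (distrC (g s) (g a)) (distrC (g t) (g b)); lra.
have fab : f a = f b.
  apply/eqP; rewrite -subr_eq0 -normr_eq0 eq_le normr_ge0 andbT leNgt.
  apply/negP => p; have p4 : 0 < `|f a - f b| / 4 by rewrite divr_gt0.
  by have [+ _] := approx _ p4; lra.
have o2 : 0 < omega / 2 by rewrite divr_gt0.
by have [_] := approx _ o2; rewrite (fg _ _ Ka Kb fab) subrr normr0; lra.
Unshelve. all: by end_near. Qed.

Section Slice.
Variable R : realType.
Local Notation lam := (@lebesgue_measure R).
Local Notation unit_itv := (@unit_itv R).

Definition slice (D : set R) (f : R -> R) (a b : R) : set R :=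
  D `&` [set t | a < f t <= b].

Definition vol (S : set R) : R := fine (lam S).

Lemma lebesgue_unit_itv : lam unit_itv = 1%:E.
Proof. by rewrite /unit_itv lebesgue_measure_itv /= lte_fin ltr01 oppr0 adde0. Qed.

Lemma volE (S : set R) : S `<=` unit_itv -> lam S = (vol S)%:E.
Proof.
move=> S01; rewrite /vol fineK // ge0_fin_numE ?lebesgue_outer_ge0 //.
apply: le_lt_trans (le_lebesgue_outer S01) _.
by rewrite lebesgue_unit_itv ltry.
Qed.

Lemma le_vol (S T : set R) : S `<=` T -> T `<=` unit_itv -> vol S <= vol T.
Proof.
move=> ST T1; rewrite -lee_fin -!volE //; first exact: le_lebesgue_outer.
exact: subset_trans T1.
Qed.

Lemma vol_ge0 (S : set R) : 0 <= vol S.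
Proof. by apply: fine_ge0; exact: lebesgue_outer_ge0. Qed.

Lemma volU (S T : set R) : S `<=` unit_itv -> T `<=` unit_itv ->
  measurable S -> measurable T -> S `&` T = set0 ->
  vol (S `|` T) = vol S + vol T.
Proof.
move=> S1 T1 mS mT dST; apply: EFin_inj; rewrite EFinD -!volE //.
  by rewrite measureU.
by move=> x [/S1|/T1].
Qed.

Lemma measurable_slice (D : set R) (f : R -> R) (a b : R) :
  D `<=` unit_itv -> measurable D -> measurable_fun unit_itv f ->
  measurable (slice D f a b).
Proof.
move=> D1 mD mf.
rewrite (_ : slice D f a b = D `&` (unit_itv `&` f @^-1` `]a, b]%classic)).
  by apply: measurableI => //; apply: mf; exact: measurable_itv.
apply/seteqP; split=> t; rewrite /slice /=.
  by move=> [Dt h]; split=> //; split; [exact: D1 | rewrite in_itv].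
by move=> [Dt [_]]; rewrite in_itv.
Qed.

Lemma vol_slice_cat (D : set R) (f : R -> R) (a b c : R) :
  D `<=` unit_itv -> measurable D -> measurable_fun unit_itv f ->
  a <= b -> b <= c ->
  vol (slice D f a c) = vol (slice D f a b) + vol (slice D f b c).
Proof.
move=> D1 mD mf ab bc; rewrite -volU; try exact: measurable_slice.
- congr vol; apply/seteqP; split=> t /=.
    move=> [Dt /andP[h1 h2]]; have [h|h] := leP (f t) b.
      by left; split=> //=; rewrite h1 h.
    by right; split=> //=; rewrite h h2.
  by case=> -[Dt /andP[h1 h2]]; split=> //=; apply/andP; split; lra.
- by move=> t [/D1].
- by move=> t [/D1].
- by apply/seteqP; split=> // t [[_ /andP[h1 h2]] [_ /andP[h3 h4]]]; lra.
Qed.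

Lemma sum_vol_slice (n : nat) (D : set R) (f : R -> R) :
  D `<=` unit_itv -> measurable D -> measurable_fun unit_itv f ->
  \sum_(i < n.+1) vol (slice D f (gridpt R n i) (gridpt R n i.+1)) <= vol D.
Proof.
move=> D1 mD mf.
have H k : \sum_(i < k) vol (slice D f (gridpt R n i) (gridpt R n i.+1))
    = vol (slice D f (gridpt R n 0) (gridpt R n k)).
  elim: k => [|k IH].
    rewrite big_ord0 (_ : slice _ _ _ _ = set0) /vol ?measure0 //.
    by apply/seteqP; split=> // t [_ /andP[h1 h2]]; lra.
  by rewrite big_ord_recr /= IH -vol_slice_cat // gridpt_le.
by rewrite H; apply: le_vol => // t [].
Qed.

End Slice.

(** * Completely dependent copulas *)

Section CompletelyDependent.
Variables (R : realType) (h : R -> R).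
Local Notation lam := (@lebesgue_measure R).
Local Notation unit_itv := (@unit_itv R).
Hypothesis Hh : lebesgue_preserving h.

Let h_fun : set_fun unit_itv unit_itv h. Proof. by case: Hh. Qed.
Let h_meas : measurable_fun unit_itv h. Proof. by case: Hh. Qed.

Let id_meas : measurable_fun unit_itv (@idfun R).
Proof. exact: measurable_id. Qed.

Let measurable_unit : measurable unit_itv.
Proof. exact: measurable_itv. Qed.

Let unitP (t : R) : unit_itv t = (0 <= t <= 1) :> Prop.
Proof. by rewrite /unit_itv /= in_itv. Qed.

(** The lower end -1 makes the half-open slice contain the point 0; likewise below for the value 0
    of h. *)
Definition left_part (x : R) : set R := slice unit_itv idfun (-1) x.

Definition low_part (y : R) : set R := slice unit_itv h (-1) y.

Let sub_slice (D : set R) f a b : D `<=` unit_itv -> slice D f a b `<=` unit_itv.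
Proof. by move=> D1 t [/D1]. Qed.

Let left_unit x : left_part x `<=` unit_itv. Proof. exact: sub_slice. Qed.
Let low_unit x : low_part x `<=` unit_itv. Proof. exact: sub_slice. Qed.
Let left_meas x : measurable (left_part x). Proof. exact: measurable_slice. Qed.
Let low_meas x : measurable (low_part x). Proof. exact: measurable_slice. Qed.

Let cd_copula_set (x y : R) : 0 <= x <= 1 -> 0 <= y <= 1 ->
  [set t : R | t \in `[0, x] /\ h t <= y] = slice (low_part y) idfun (-1) x.
Proof.
move=> /andP[x0 x1] hy; apply/seteqP; split=> t /=; rewrite in_itv /=.
  move=> [/andP[t0 tx] ht].
  have t1 : unit_itv t by rewrite unitP t0 (le_trans tx x1).
  have := h_fun t1; rewrite unitP => /andP[h0 _].
  by split; [split=> //=; rewrite ht andbT | rewrite /= tx andbT]; lra.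
move=> [[+ /= /andP[_ ht]] /andP[_ tx]]; rewrite unitP => /andP[t0 _].
by rewrite t0 tx ht.
Qed.

Lemma cd_copula_col (x y : R) : 0 <= x <= 1 -> 0 <= y <= 1 ->
  cd_copula h (x, y) = vol (slice (low_part y) idfun (-1) x).
Proof. by move=> hx hy; rewrite /cd_copula /= cd_copula_set. Qed.

Lemma cd_copula_row (x y : R) : 0 <= x <= 1 -> 0 <= y <= 1 ->
  cd_copula h (x, y) = vol (slice (left_part x) h (-1) y).
Proof.
move=> hx hy; rewrite cd_copula_col //; congr vol.
by apply/seteqP; split=> t [[? ?] ?].
Qed.

Lemma cd_copula_colB (x0 x1 y : R) : 0 <= x0 -> x0 <= x1 -> x1 <= 1 ->
  0 <= y <= 1 ->
  cd_copula h (x1, y) - cd_copula h (x0, y) = vol (slice (low_part y) idfun x0 x1).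
Proof.
move=> h0 h01 h1 hy; rewrite !cd_copula_col //; try (apply/andP; split; lra).
by rewrite (vol_slice_cat (b := x0)) //; lra.
Qed.

Lemma cd_copula_rowB (x y0 y1 : R) : 0 <= y0 -> y0 <= y1 -> y1 <= 1 ->
  0 <= x <= 1 ->
  cd_copula h (x, y1) - cd_copula h (x, y0) = vol (slice (left_part x) h y0 y1).
Proof.
move=> h0 h01 h1 hx; rewrite !cd_copula_row //; try (apply/andP; split; lra).
by rewrite (vol_slice_cat (b := y0)) //; lra.
Qed.

Lemma vol_slice_splitC (D : set R) (f : R -> R) (a b : R) :
  D `<=` unit_itv -> measurable D -> measurable_fun unit_itv f ->
  vol (slice unit_itv f a b) =
  vol (slice D f a b) + vol (slice (unit_itv `\` D) f a b).
Proof.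
move=> D1 mD mf; have mC : measurable (unit_itv `\` D) by exact: measurableD.
have C1 : unit_itv `\` D `<=` unit_itv by move=> t [].
rewrite -volU; try exact: measurable_slice; try exact: sub_slice.
- congr vol; apply/seteqP; split=> t /=.
    move=> [t1 ht]; have [Dt|nDt] := pselect (D t); first by left.
    by right; split.
  by case=> -[Dt ht]; split=> //; [exact: D1 | case: Dt].
- by apply/seteqP; split=> // t [[Dt _] [[_ nDt] _]].
Qed.

Lemma vol_slice_id (a b : R) : 0 <= a -> a <= b -> b <= 1 ->
  vol (slice unit_itv idfun a b) = b - a.
Proof.
move=> a0 ab b1; rewrite (_ : slice _ _ _ _ = `]a, b]%classic).
  rewrite /vol lebesgue_measure_itv /= lte_fin; case: ltP => // ba.
  by rewrite /=; lra.
apply/seteqP; split=> t /=; rewrite /slice /= unitP in_itv /=; first by case.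
by move=> /andP[h1 h2]; rewrite h1 h2; split=> //; apply/andP; split; lra.
Qed.

Lemma vol_slice_preserving (a b : R) : 0 <= a -> a <= b -> b <= 1 ->
  vol (slice unit_itv h a b) = b - a.
Proof.
move=> a0 ab b1; have [_ _ pres] := Hh.
rewrite /vol (_ : slice _ _ _ _ = unit_itv `&` h @^-1` `]a, b]%classic).
  rewrite pres; last 2 first.
  - exact: measurable_itv.
  - by move=> t /=; rewrite unitP in_itv /= => /andP[? ?]; apply/andP; split; lra.
  rewrite lebesgue_measure_itv /= lte_fin; case: ltP => // ba.
  by rewrite /=; lra.
by apply/seteqP; split=> t; rewrite /slice /= in_itv.
Qed.

Variable K : set R.

Let CK1 : unit_itv `\` K `<=` unit_itv. Proof. by move=> t []. Qed.

(** The increment of the copula is the measure of the t in ]x0, x1] with h t <= y; if the graph over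
    [K] stays below y there, only points outside [K] are missing. The row version uses that h
    preserves the measure, and the low versions that only points outside [K] are counted. *)
Lemma col_defect_high (x0 x1 y : R) : 0 <= x0 -> x0 <= x1 -> x1 <= 1 ->
  0 <= y <= 1 -> (forall t, K t -> x0 < t <= x1 -> h t <= y) ->
  (x1 - x0) - (cd_copula h (x1, y) - cd_copula h (x0, y))
  <= vol (slice (unit_itv `\` K) idfun x0 x1).
Proof.
move=> h0 h01 h1 hy high; rewrite cd_copula_colB // -(vol_slice_id h0 h01 h1).
rewrite (vol_slice_splitC (D := low_part y)) // addrAC subrr add0r.
apply: le_vol; last exact: sub_slice.
move=> t [[t1 nl] ht]; split=> //; split=> // Kt; apply: nl.
split=> //=; rewrite (high t Kt ht) andbT.
by have := h_fun t1; rewrite unitP => /andP[+ _]; lra.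
Qed.

Lemma row_defect_high (x y0 y1 : R) : 0 <= y0 -> y0 <= y1 -> y1 <= 1 ->
  0 <= x <= 1 -> (forall t, K t -> y0 < h t <= y1 -> t <= x) ->
  (y1 - y0) - (cd_copula h (x, y1) - cd_copula h (x, y0))
  <= vol (slice (unit_itv `\` K) h y0 y1).
Proof.
move=> h0 h01 h1 hx high; rewrite cd_copula_rowB // -(vol_slice_preserving h0 h01 h1).
rewrite (vol_slice_splitC (D := left_part x)) // addrAC subrr add0r.
apply: le_vol; last exact: sub_slice.
move=> t [[t1 nl] ht]; split=> //; split=> // Kt; apply: nl.
split=> //=; rewrite (high t Kt ht) andbT.
by move: t1; rewrite unitP => /andP[+ _]; lra.
Qed.

Lemma col_slack_low (x0 x1 y : R) : 0 <= x0 -> x0 <= x1 -> x1 <= 1 ->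
  0 <= y <= 1 -> (forall t, K t -> x0 < t <= x1 -> y < h t) ->
  cd_copula h (x1, y) - cd_copula h (x0, y)
  <= vol (slice (unit_itv `\` K) idfun x0 x1).
Proof.
move=> h0 h01 h1 hy low; rewrite cd_copula_colB //.
apply: le_vol; last exact: sub_slice.
move=> t [[t1 /andP[_ hty]] ht]; split=> //; split=> // Kt.
by have := low t Kt ht; rewrite ltNge hty.
Qed.

Lemma row_slack_low (x y0 y1 : R) : 0 <= y0 -> y0 <= y1 -> y1 <= 1 ->
  0 <= x <= 1 -> (forall t, K t -> y0 < h t <= y1 -> x < t) ->
  cd_copula h (x, y1) - cd_copula h (x, y0)
  <= vol (slice (unit_itv `\` K) h y0 y1).
Proof.
move=> h0 h01 h1 hx low; rewrite cd_copula_rowB //.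
apply: le_vol; last exact: sub_slice.
move=> t [[t1 /andP[_ /= htx]] ht]; split=> //; split=> // Kt.
by have := low t Kt ht; rewrite ltNge htx.
Qed.

End CompletelyDependent.

(** * Grid error of a mutually completely dependent copula *)

Lemma count_gridpt (R : realType) (n m : nat) (a b : R) : a <= b ->
  \sum_(j < m) (if a <= gridpt R n j < b then n.+1%:R^-1 else 0)
  <= b - a + n.+1%:R^-1.
Proof.
move=> ab; have d0 : 0 < n.+1%:R^-1 :> R by rewrite invr_gt0.
(* Invariant for the induction on m: the grid steps starting at the counted points are disjoint and
   lie between a and the minimum of [gridpt R n m] and b + delta. *)
suff H : \sum_(j < m) (if a <= gridpt R n j < b then n.+1%:R^-1 else 0)
  <= Num.max 0 (Num.min (gridpt R n m) (b + n.+1%:R^-1) - a).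
  apply: le_trans H _; rewrite ge_max; apply/andP; split.
    by rewrite addr_ge0 ?subr_ge0 // ltW.
  by rewrite [leRHS]addrAC lerD2r ge_min lexx orbT.
elim: m => [|m IH]; first by rewrite big_ord0 le_max lexx.
rewrite big_ord_recr /= gridptS.
move: IH; set S := \sum_(j < m) _; move: d0; set d := n.+1%:R^-1.
move: (gridpt R n m) => g d0; clearbody S d.
case: (boolP (a <= g < b)) => [/andP[p1 p2]|/nandP[|]];
  rewrite -?leNgt -?ltNge /= /Num.max /Num.min; repeat case: ifPn; rewrite -?leNgt; lra.
Qed.

Section McdGrid.
Variables (R : realType) (h : R -> R) (K : set R) (n : nat) (omega : R).
Local Notation unit_itv := (@unit_itv R).
Local Notation gridpt := (gridpt R n).
Local Notation delta := (n.+1%:R^-1 : R).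
Local Notation cell := ('I_n.+1 * 'I_n.+1)%type.
Hypotheses (Hh : lebesgue_preserving h) (mK : measurable K).
Hypothesis omega_gt0 : 0 < omega.
Hypothesis h_modulus : forall s t, K s -> K t ->
  `|s - t| < delta -> `|h s - h t| < omega.
Hypothesis hinv_modulus : forall s t, K s -> K t ->
  `|h s - h t| < delta -> `|s - t| < omega.
Variables (A : R * R -> R) (HA : plane_copula A).
Hypothesis Agrid : forall i j, (i <= n.+1)%N -> (j <= n.+1)%N ->
  A (gridpt i, gridpt j) = cd_copula h (gridpt i, gridpt j).

Let in_col (i : nat) (t : R) := gridpt i < t <= gridpt i.+1.

(* high: the cell lies above the graph of h over K, as seen from its column
   (col_) or its row (row_); low: below the graph; mid: neither. *)
Let col_high (i j : nat) := forall t, K t -> in_col i t -> h t <= gridpt j.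
Let col_low (i j : nat) := forall t, K t -> in_col i t -> gridpt j.+1 < h t.
Let col_mid (i j : nat) := ~ col_high i j /\ ~ col_low i j.
Let row_high (i j : nat) := forall t, K t -> in_col j (h t) -> t <= gridpt i.
Let row_low (i j : nat) := forall t, K t -> in_col j (h t) -> gridpt i.+1 < t.
Let row_mid (i j : nat) := ~ row_high i j /\ ~ row_low i j.

Definition graph_above (Q : cell) : bool :=
  `[< col_high Q.1 Q.2 /\ row_high Q.1 Q.2 >].

Let u (i : nat) := vol (slice (unit_itv `\` K) idfun (gridpt i) (gridpt i.+1)).
Let v (j : nat) := vol (slice (unit_itv `\` K) h (gridpt j) (gridpt j.+1)).
Let cm (i j : nat) : R := if `[< col_mid i j >] then delta else 0.
Let rm (i j : nat) : R := if `[< row_mid i j >] then delta else 0.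

Let delta_gt0 : 0 < delta.
Proof. by rewrite invr_gt0 ltr0n. Qed.

Let grid01 (i : nat) : (i <= n.+1)%N -> 0 <= gridpt i <= 1.
Proof. by move=> hi; rewrite gridpt_ge0 -(gridpt1 R n) gridpt_le. Qed.

(** If the cell is high in both senses, its defect only sees points outside [K]. Otherwise it is low
    or mid in its column or its row: if low, one increment only sees points outside [K]; if mid, the
    Lipschitz bound delta is charged to [cm] or [rm]. *)
Let cell_term_le (Q : cell) :
  (if graph_above Q then grid_defect A Q else grid_slack A Q) <=
  u Q.1 + v Q.2 + (cm Q.1 Q.2 + rm Q.1 Q.2).
Proof.
case: Q => i j /=.
have i0 : 0 <= gridpt i by exact: gridpt_ge0.
have j0 : 0 <= gridpt j by exact: gridpt_ge0.
have gx : gridpt i <= gridpt i.+1 by exact: gridpt_le.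
have gy : gridpt j <= gridpt j.+1 by exact: gridpt_le.
have /andP[_ i1] := grid01 (ltn_ord i); have /andP[_ j1] := grid01 (ltn_ord j).
have iI := grid01 (ltnW (ltn_ord i)); have jI := grid01 (ltnW (ltn_ord j)).
have iI' := grid01 (ltn_ord i); have jI' := grid01 (ltn_ord j).
have u0 : 0 <= u i by exact: vol_ge0.
have v0 : 0 <= v j by exact: vol_ge0.
have cm0 : 0 <= cm i j by rewrite /cm; case: ifP => // _; exact: ltW.
have rm0 : 0 <= rm i j by rewrite /rm; case: ifP => // _; exact: ltW.
have A00 := Agrid (ltnW (ltn_ord i)) (ltnW (ltn_ord j)).
have A10 := Agrid (ltn_ord i) (ltnW (ltn_ord j)).
have A01 := Agrid (ltnW (ltn_ord i)) (ltn_ord j).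
have A11 := Agrid (ltn_ord i) (ltn_ord j).
have dg k : gridpt k.+1 - gridpt k = delta by rewrite gridptS addrAC subrr add0r.
case: ifPn => [/asboolP[/= hc hr]|/asboolPn/= nG].
  rewrite /grid_defect /cell_defect /= A00 A10 A01.
  have := col_defect_high Hh i0 gx i1 jI hc.
  have := row_defect_high Hh j0 gy j1 iI hr.
  by rewrite -/(u i) -/(v j); lra.
rewrite /grid_slack /=.
have [hc|hc] := pselect (col_high i j); last first.
  have [lc|lc] := pselect (col_low i j).
    rewrite ge_min; apply/orP; right; rewrite A11 A01.
    have := col_slack_low Hh i0 gx i1 jI' lc; rewrite -/(u i); lra.
  rewrite ge_min; apply/orP; right.
  have := pc_lip1 HA (gridpt j.+1) gx.
  rewrite dg => le.
  have cE : cm i j = delta by rewrite /cm asboolT.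
  apply: le_trans le _; rewrite cE; move: delta => d; lra.
have hr : ~ row_high i j by move=> hr; apply: nG.
have [lr|lr] := pselect (row_low i j).
  rewrite ge_min; apply/orP; left; rewrite A11 A10.
  have := row_slack_low Hh j0 gy j1 iI' lr; rewrite -/(v j); lra.
rewrite ge_min; apply/orP; left.
have := pc_lip2 HA (gridpt i.+1) gy.
rewrite dg => le.
have rE : rm i j = delta by rewrite /rm asboolT.
by apply: le_trans le _; rewrite rE; move: delta => d; lra.
Qed.

Let mid_count (c : R) (P : nat -> Prop) :
  (forall j, P j -> gridpt j < c + omega /\ c - omega <= gridpt j.+1) ->
  \sum_(j < n.+1) (if `[< P j >] then delta else 0) <= 2 * omega + 2 * delta.
Proof.
move=> hP.
have ab : c - omega - delta <= c + omega.
  by move: delta_gt0 omega_gt0; move: delta => d; lra.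
apply: (@le_trans _ _ (c + omega - (c - omega - delta) + delta)); last first.
  by move: delta => d; lra.
apply: le_trans (count_gridpt n n.+1 ab); apply: ler_sum => j _.
case: ifPn => [/asboolP /hP [h1 h2]|_]; last by case: ifP => // _; exact: ltW.
by rewrite h1 lerBlDr -gridptS h2.
Qed.

(** Within one column the graph over [K] stays within omega of a single value h s, so only rows near
    h s can be mid. If the column misses [K], all its cells are vacuously high. *)
Let sum_cm (i : nat) : \sum_(j < n.+1) cm i j <= 2 * omega + 2 * delta.
Proof.
have [[s [Ks si]]|none] := pselect (exists s, K s /\ in_col i s); last first.
  rewrite big1; first by move: delta_gt0 omega_gt0; move: delta => d; lra.
  move=> j _; rewrite /cm asboolF // => -[nh _]; apply: nh => t Kt ti.
  by case: none; exists t.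
apply: (mid_count (c := h s)) => j [nh nl].
have close t : K t -> in_col i t -> `|h t - h s| < omega.
  move=> Kt ti; apply: h_modulus => //; move: ti si; rewrite /in_col gridptS.
  by move: delta => d; rewrite ltr_norml; lra.
split.
  rewrite ltNge; apply/negP => le; apply: nh => t Kt ti.
  by have := close t Kt ti; rewrite ltr_norml; lra.
rewrite leNgt; apply/negP => lt; apply: nl => t Kt ti.
by have := close t Kt ti; rewrite ltr_norml; lra.
Qed.

Let sum_rm (j : nat) : \sum_(i < n.+1) rm i j <= 2 * omega + 2 * delta.
Proof.
have [[s [Ks sj]]|none] := pselect (exists s, K s /\ in_col j (h s)); last first.
  rewrite big1; first by move: delta_gt0 omega_gt0; move: delta => d; lra.
  move=> i _; rewrite /rm asboolF // => -[nh _]; apply: nh => t Kt tj.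
  by case: none; exists t.
apply: (mid_count (c := s) (P := fun i => row_mid i j)) => i [nh nl].
have close t : K t -> in_col j (h t) -> `|t - s| < omega.
  move=> Kt tj; apply: hinv_modulus => //; move: tj sj; rewrite /in_col gridptS.
  by move: delta => d; rewrite ltr_norml; lra.
split.
  rewrite ltNge; apply/negP => le; apply: nh => t Kt tj.
  by have := close t Kt tj; rewrite ltr_norml; lra.
rewrite leNgt; apply/negP => lt; apply: nl => t Kt tj.
by have := close t Kt tj; rewrite ltr_norml; lra.
Qed.

Let sum_const (c : R) : \sum_(i < n.+1) delta * c = c.
Proof.
by rewrite sumr_const card_ord -[LHS]mulr_natl mulrA divff ?mul1r // pnatr_eq0.
Qed.

Lemma grid_error_graph_above :
  grid_error A graph_above <=
  2 * vol (unit_itv `\` K) + 2 * (2 * omega + 2 * delta).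
Proof.
have C1 : unit_itv `\` K `<=` unit_itv by move=> t [].
have mC : measurable (unit_itv `\` K).
  by apply: measurableD => //; exact: measurable_itv.
have mh : measurable_fun unit_itv h by case: Hh.
have su : \sum_(i < n.+1) u i <= vol (unit_itv `\` K).
  by apply: sum_vol_slice => //; exact: measurable_id.
have sv : \sum_(j < n.+1) v j <= vol (unit_itv `\` K) by exact: sum_vol_slice.
rewrite /grid_error mulr_sumr.
apply: (@le_trans _ _ (\sum_(Q : cell) (delta * u Q.1 + delta * v Q.2
   + (delta * cm Q.1 Q.2 + delta * rm Q.1 Q.2)))).
  apply: ler_sum => Q _; rewrite -!mulrDr ler_pM2l //; exact: cell_term_le.
rewrite !big_split /=.
rewrite -(pair_bigA _ (fun i j : 'I_n.+1 => delta * u i)) /=.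
rewrite -(pair_bigA _ (fun i j : 'I_n.+1 => delta * v j)) /=.
rewrite -(pair_bigA _ (fun i j : 'I_n.+1 => delta * cm i j)) /=.
rewrite -(pair_bigA _ (fun i j : 'I_n.+1 => delta * rm i j)) /=.
under eq_bigr do rewrite sum_const.
rewrite [X in _ + X + _ <= _]exchange_big /=.
under [X in _ + X + _ <= _]eq_bigr do rewrite sum_const.
have Sc : \sum_(i < n.+1) \sum_(j < n.+1) delta * cm i j <= 2 * omega + 2 * delta.
  rewrite -[leRHS]sum_const; apply: ler_sum => i _.
  by rewrite -mulr_sumr ler_pM2l.
have Sr : \sum_(i < n.+1) \sum_(j < n.+1) delta * rm i j <= 2 * omega + 2 * delta.
  rewrite exchange_big /= -[leRHS]sum_const; apply: ler_sum => i _.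
  by rewrite -mulr_sumr ler_pM2l.
have key (a b c d V W : R) : a <= V -> b <= V -> c <= W -> d <= W ->
  a + b + (c + d) <= 2 * V + 2 * W by lra.
exact: key.
Qed.

End McdGrid.

Lemma mcd_grid_error (R : realType) (A : R * R -> R) (eps : R) :
  mcd_copula A -> 0 < eps ->
  exists n, exists G : 'I_n.+1 * 'I_n.+1 -> bool,
    n.+1%:R^-1 < eps /\ grid_error (clamped A) G < eps.
Proof.
move=> [copA [h [Hh [_ hinj _] hA]]] eps0.
(* With e = eps / 16 bounding the measure outside K, omega and the mesh, the error is at most 2 e +
   2 (2 e + 2 e) = 10 e < eps. *)
have e16 : 0 < eps / 16 by rewrite divr_gt0.
have mh : measurable_fun (@unit_itv R) h by case: Hh.
have mU : measurable (@unit_itv R) by exact: measurable_itv.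
(* Lusin's theorem. *)
have [|K [cK K1 volK ch]] := measurable_almost_continuous mU _ e16 mh.
  by rewrite /= lebesgue_unit_itv ltry.
have mK : measurable K.
  by apply: closed_measurable; apply: compact_closed => //; exact: Rhausdorff.
have cid : {within K, continuous (@idfun R)}.
  by apply: continuous_subspaceT => x; exact: cvg_id.
have hinjK s t : K s -> K t -> h s = h t -> s = t.
  by move=> Ks Kt; apply: hinj; rewrite inE; exact: K1.
have hK s t : K s -> K t -> idfun s = idfun t -> h s = h t.
  by move=> _ _; rewrite /= => ->.
have [d1 d10 hd1] := compact_modulus cK cid ch hK e16.
(* Injectivity of h enters here: it makes t a uniformly continuous function of h t on K. *)
have [d2 d20 hd2] := compact_modulus cK ch cid hinjK e16.
pose d := Num.min (Num.min d1 d2) (eps / 16).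
have d0 : 0 < d by rewrite !lt_min d10 d20 e16.
have [n hn] := natSinv_lt d0.
move: (hn); rewrite !lt_min => /andP[/andP[hn1 hn2] hn3].
exists n, (@graph_above R h K n).
have vK : vol (@unit_itv R `\` K) < eps / 16.
  by rewrite -lte_fin -volE // => t [].
split; first by apply: lt_trans hn3 _; lra.
apply: le_lt_trans (_ : 2 * vol (@unit_itv R `\` K) +
   2 * (2 * (eps / 16) + 2 * n.+1%:R^-1) < eps); last first.
  by move: hn3 vK; move: (n.+1%:R^-1 : R) => x; lra.
apply: (grid_error_graph_above Hh mK e16).
- by move=> s t Ks Kt st; apply: hd1 => //; exact: lt_trans hn1.
- by move=> s t Ks Kt st; apply: hd2 => //; exact: lt_trans hn2.
- exact: plane_copula_clamped.
move=> i j hi hj; rewrite clamped_id ?hA //.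
all: by rewrite /unit_square /unit_itv; split; rewrite /= in_itv /= gridpt_ge0
  -(gridpt1 R n) gridpt_le.
Qed.

(** * Continuity *)

Lemma plane_copula_itv (R : realType) (A : R * R -> R) (x y : R) :
  plane_copula A -> 0 <= x <= 1 -> 0 <= y <= 1 -> 0 <= A (x, y) <= 1.
Proof.
move=> HA /andP[x0 x1] hy; have /andP[y0 y1] := hy.
have := pc_mono1 HA y x0; have := pc_mono1 HA y x1.
by rewrite (pc_bot1 HA) (pc_top1 HA) //; lra.
Qed.

Lemma le_d_infty (R : realType) (A B : R * R -> R) (p : R * R) :
  copula A -> copula B -> `|clamped A p - clamped B p| <= d_infty A B.
Proof.
move=> cA cB.
have HA := plane_copula_clamped cA; have HB := plane_copula_clamped cB.
have sq : unit_square (clamp p.1, clamp p.2).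
  by split; rewrite /unit_itv /= in_itv /=; exact: clamp_itv.
rewrite {1}/clamped {1}/clamped.
(* The supremum is a genuine one, since differences of values in [0, 1] are bounded by 1. *)
apply: ub_le_sup; last by exists (clamp p.1, clamp p.2).
exists 1 => _ [[x y] /= sxy <-]; rewrite -(clamped_id A sxy) -(clamped_id B sxy).
move: sxy => [/=]; rewrite /unit_itv /= !in_itv /= => hx hy.
have := plane_copula_itv HA hx hy; have := plane_copula_itv HB hx hy.
by rewrite ler_norml; lra.
Qed.

(** A defect combines four values of A and a slack compares differences of two, so each moves by at
    most 4 D; delta times the number of cells is n + 1. *)
Lemma grid_error_perturb (R : realType) (n : nat) (A B : R * R -> R) (D : R)
    (G : 'I_n.+1 * 'I_n.+1 -> bool) :
  (forall p, `|A p - B p| <= D) ->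
  grid_error B G <= grid_error A G + 4 * n.+1%:R * D.
Proof.
move=> hAB.
have hAB' p : A p - D <= B p <= A p + D.
  by have := hAB p; rewrite ler_norml; lra.
have m0 : n.+1%:R != 0 :> R by rewrite pnatr_eq0.
rewrite /grid_error.
apply: (@le_trans _ _ (n.+1%:R^-1 * \sum_(Q : 'I_n.+1 * 'I_n.+1)
   ((if G Q then grid_defect A Q else grid_slack A Q) + 4 * D))).
  rewrite ler_pM2l ?invr_gt0 ?ltr0n //; apply: ler_sum => Q _.
  rewrite /grid_defect /grid_slack /cell_defect.
  have h11 := hAB' (gridpt R n Q.1.+1, gridpt R n Q.2.+1).
  have h10 := hAB' (gridpt R n Q.1.+1, gridpt R n Q.2).
  have h01 := hAB' (gridpt R n Q.1, gridpt R n Q.2.+1).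
  have h00 := hAB' (gridpt R n Q.1, gridpt R n Q.2).
  case: (G Q); first by lra.
  by rewrite /Num.min; repeat case: ifPn; rewrite -?leNgt; lra.
rewrite big_split /= mulrDr lerD2l sumr_const card_prod card_ord.
rewrite -[X in _ * X]mulr_natl natrM le_eqVlt; apply/orP; left; apply/eqP.
by move: (n.+1%:R : R) m0 => m m0; field.
Qed.

Lemma length_measure_bounds (R : realType) (A : R * R -> R) : copula A ->
  ((Num.sqrt 2)^-1%:E <= length_measure A <= 1%:E)%E.
Proof.
move=> cA; have HA := plane_copula_clamped cA; rewrite -length_measure_clamped.
apply/andP; split; apply/lee_addgt0Pr => e e0.
  have e2 : 0 < e / 2 by rewrite divr_gt0.
  have [n hn] := natSinv_lt e2.
  apply: le_trans (leeD2r _ (length_measure_ge_sqrt2 n HA)).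
  rewrite -EFinD lee_fin; move: hn; have : 0 < n.+1%:R^-1 :> R by rewrite invr_gt0.
  move: (n.+1%:R^-1 : R) => d d0 hd.
  have s1 : (Num.sqrt 2)^-1 <= 1 :> R.
    by rewrite invf_le1 ?sqrt2_gt0 //; have := sqr_sqrt2 R; have := sqrt2_gt0 R; nra.
  have := ler_wpM2r (ltW d0) s1; lra.
have [n hn] := natSinv_lt e0.
apply: le_trans (length_measure_le_1delta n HA) _.
by rewrite lee_fin lerD2l ltW.
Qed.

Theorem corollary3p2 (R : realType) :
  (forall A : R * R -> R, mcd_copula A ->
    ((Num.sqrt 2)^-1%:E <= length_measure A <= 1%:E)%E) /\
  (forall A : R * R -> R, mcd_copula A ->
    forall eps : R, 0 < eps ->
    exists2 delta : R, 0 < delta &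
      forall B : R * R -> R, mcd_copula B -> d_infty A B < delta ->
        (`|length_measure B - length_measure A| < eps%:E)%E).
Proof.
split=> [A [cA _]|A mA eps eps0]; first exact: length_measure_bounds.
(* The two grid estimates put the length measures within 2 e + 4 e + 3 e = 9 e of each other, well
   below 20 e. *)
pose e := eps / 20; have e0 : 0 < e by rewrite divr_gt0.
have cA : copula A by case: mA.
have [n [G [hn hG]]] := mcd_grid_error mA e0.
have m0 : 0 < n.+1%:R :> R by rewrite ltr0n.
(* At this distance [grid_error_perturb] adds less than e to the error of A. *)
exists (e / (4 * n.+1%:R)) => [|B [cB _] dAB]; first by rewrite divr_gt0 ?mulr_gt0.
have hGB : grid_error (clamped B) G < 2 * e.
  apply: le_lt_trans (grid_error_perturb G (fun p => le_d_infty p cA cB)) _.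
  rewrite ltr_pdivlMr ?mulr_gt0 // in dAB.
  have : 4 * n.+1%:R * d_infty A B < e by rewrite mulrC.
  by move: hG; move: (4 * n.+1%:R * d_infty A B) (grid_error _ _) => x y; lra.
have HA := plane_copula_clamped cA; have HB := plane_copula_clamped cB.
have uA := length_measure_le_grid HA G; have lA := length_measure_ge_grid HA G.
have uB := length_measure_le_grid HB G; have lB := length_measure_ge_grid HB G.
rewrite !length_measure_clamped in uA lA uB lB.
move: uA lA uB lB; have := length_measure_bounds cA; have := length_measure_bounds cB.
(* The general bounds exclude infinite values, so the rest is real arithmetic. *)
case: (length_measure A) => [a| |] //=; case: (length_measure B) => [b| |] //=;
  rewrite ?leye_eq ?andbF //.
move=> _ _; rewrite !lee_fin lte_fin.
have eE : eps = 20 * e by rewrite /e; field.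
move: hn hG hGB.
move: (n.+1%:R^-1 : R) (grid_error _ _) (grid_error _ _) (grid_length _ _).
by move=> d eA eB V h1 h2 h3 h4 h5 h6 h7; rewrite eE ltr_norml; lra.
Qed.
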